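(* Let $\alpha<0$, let $K$ be a kernel on $E$ defining a locally trace class integral operator on $L^2(E,\lambda)$, and let $\xi$ be an $\alpha$-determinantal process with kernel $K$ with respect to $\lambda$ (not almost surely equal to the empty configuration). Then $\xi$ is not infinitely divisible.
   Context: $E$ is a locally compact Polish space and $\lambda$ a Radon measure on $E$. A point process on $E$ is a random variable with values in the space $\mathcal X$ of locally finite configurations (non-negative integer-valued Radon measures on $E$) with the Borel $\sigma$-algebra of the vague topology; multiple points are allowed. A point process is infinitely divisible if, for every integer $N\ge1$, it has the same law as the sum (as measures) of $N$ independent identically distributed point processes on $E$. For an $n\times n$ matrix $A=(a_{ij})$, $\det_\alpha A=\sum_{\sigma\in\Sigma_n}\alpha^{n-\nu(\sigma)}\prod_{i=1}^n a_{i\sigma(i)}$, where $\Sigma_n$ is the set of permutations of $\{1,\dots,n\}$ and $\nu(\sigma)$ is the number of cycles of $\sigma$. A kernel is a function $K:E^2\to\mathbb R$ or $\mathbb C$. It is always assumed that $K$ defines a locally trace class integral operator $\mathcal K$ on $L^2(E,\lambda)$, i.e. for every compact $\Lambda\subset E$ the operator $\mathcal K_\Lambda=p_\Lambda\mathcal K p_\Lambda$ is trace class, where $p_\Lambda$ is the orthogonal projection of $L^2(E,\lambda)$ onto $L^2(\Lambda,\lambda)$. $\mathcal I$ is the identity and $\operatorname{Det}$ the Fredholm determinant. An $\alpha$-determinantal process with kernel $K$ with respect to $\lambda$ is a point process $\xi$ whose correlation functions with respect to $\lambda$ are $\rho_n(x_1,\dots,x_n)=\det_\alpha(K(x_i,x_j))_{1\le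 i,j\le n}$; that is, for all mutually disjoint relatively compact $\Lambda_1,\dots,\Lambda_d\subset E$ and positive integers $n_1,\dots,n_d$ with sum $n$, $\mathbb E\big(\prod_{i=1}^d\xi(\Lambda_i)^{(n_i)}\big)=\int_{\Lambda_1^{n_1}\times\dots\times\Lambda_d^{n_d}}\rho_n\,d\lambda^{\otimes n}$, where $a^{(k)}=\prod_{i=0}^{k-1}(a-i)$. Equivalently (under the locally trace class assumption), $\mathbb E[\exp(-\int_E f\,d\xi)]=\operatorname{Det}(\mathcal I+\alpha\mathcal K[1-e^{-f}])^{-1/\alpha}$ for every compactly supported non-negative function $f$ on $E$, where $\mathcal K[1-e^{-f}]=\sqrt{1-e^{-f}}\,\mathcal K\sqrt{1-e^{-f}}$. Convention on diagonals: the kernel of a trace class operator on $L^2(\Lambda,\lambda)$ is taken in the form $\sum_{k}a_k\varphi_k(x)\overline{\psi_k(y)}$, with $a_k\ge0$ the singular values and $(\varphi_k),(\psi_k)$ orthonormal bases of $L^2(\Lambda,\lambda)$, so that expressions in $(K(x_i,x_j))_{i,j}$ are well defined for $\lambda^{\otimes n}$-a.e. $(x_1,\dots,x_n)$, including diagonal entries. *)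

(* Defs.v *)
From HB Require Import structures.
From mathcomp Require Import all_boot all_order all_algebra all_fingroup.
From mathcomp Require Import all_classical all_reals all_analysis.
From mathcomp Require Import complex.

Set Implicit Arguments.
Unset Strict Implicit.
Unset Printing Implicit Defensive.

Import Order.TTheory GRing.Theory Num.Theory.
Import numFieldNormedType.Exports.

Local Open Scope classical_set_scope.
Local Open Scope ring_scope.
Local Open Scope complex_scope.

Definition det_alpha (A : comPzRingType) (n : nat) (alpha : A) (M : 'M[A]_n) : A :=
  \sum_(s : 'S_n) alpha ^+ (n - #|porbits s|)%N * \prod_(i < n) M i (s i).

Section Space.
Variables (R : realType) (E : ptopologicalType).

Definition polish : Prop :=
  (exists2 D : set E, countable D & dense D) /\
  exists dist : E -> E -> R,
    [/\ forall x y, dist x y = 0 <-> x = y,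
        forall x y, dist x y = dist y x,
        forall x y z, dist x z <= dist x y + dist y z,
        forall (x : E) (A : set E), nbhs x A <->
          exists2 e : R, 0 < e & [set y | dist x y < e] `<=` A &
        forall u : nat -> E,
          (forall e : R, 0 < e -> exists N : nat,
             forall m n : nat, (N <= m)%N -> (N <= n)%N -> dist (u m) (u n) < e) ->
          exists l : E, u @ \oo --> l].

End Space.

Notation borel E := (g_sigma_algebraType (@open E)).

Section Configurations.
Variables (R : realType) (E : ptopologicalType).

Definition radon (mu : set (borel E) -> \bar R) : Prop :=
  (forall C : set E, compact C -> (mu C < +oo)%E) /\
  (forall B : set (borel E), measurable B ->
    mu B = ereal_sup [set mu C | C in [set C : set E | compact C /\ C `<=` B]]).

Record config := Config {
  config_measure :> {measure set (borel E) -> \bar R};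
  config_integer : forall B : set (borel E), measurable B ->
    config_measure B = +oo%E \/ exists k : nat, config_measure B = k%:R%:E;
  config_radon : radon config_measure
}.

Lemma mzero_integer (B : set (borel E)) : measurable B ->
  @mzero _ (borel E) R B = +oo%E \/
  exists k : nat, @mzero _ (borel E) R B = k%:R%:E.
Proof. by move=> _; right; exists 0%N. Qed.

Lemma mzero_radon : radon (@mzero _ (borel E) R).
Proof.
split=> [C _|B _]; first by rewrite /mzero ltry.
apply/eqP; rewrite eq_le; apply/andP; split.
  by apply: ereal_sup_ubound; exists set0 => //; split; [exact: compact0|exact: sub0set].
by apply: ge_ereal_sup => _ [C _ <-].
Qed.

(* Only used as the default point of config. *)
Definition empty_config : config := Config mzero_integer mzero_radon.

HB.instance Definition _ := gen_eqMixin config.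
HB.instance Definition _ := gen_choiceMixin config.
HB.instance Definition _ := isPointed.Build config empty_config.

Definition test_function : Type :=
  {f : E -> R | continuous f /\ compact (closure [set x | f x != 0])}.

Definition vague_eval (mu : config) : prod_topology (fun _ : test_function => R) :=
  fun f => (\int[mu]_x (sval f x))%R.

End Configurations.

(* The space of configurations with its vague topology, i.e. the coarsest one
   making mu |-> \int f dmu continuous for all f in C_c(E). *)
Notation vague_config R E := (initial_topology (@vague_eval R E)).
Notation config_space R E := (borel (vague_config R E)).

Section Laws.
Variables (R : realType) (E : ptopologicalType).

Definition same_law d1 d2 (W1 : measurableType d1) (W2 : measurableType d2)
    (P1 : probability W1 R) (P2 : probability W2 R)
    (X1 : {mfun W1 >-> config_space R E}) (X2 : {mfun W2 >-> config_space R E}) : Prop :=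
  forall B : set (config_space R E), measurable B ->
    P1 (X1 @^-1` B) = P2 (X2 @^-1` B).

(* The events B i may be taken to be the whole space, so the product rule over
   the full family contains the one over each subfamily. *)
Definition independent d (W : measurableType d) (P : probability W R) (N : nat)
    (X : 'I_N -> {mfun W >-> config_space R E}) : Prop :=
  forall B : 'I_N -> set (config_space R E), (forall i, measurable (B i)) ->
    P (\bigcap_(i in [set: 'I_N]) (X i @^-1` B i)) =
    (\prod_(i < N) P (X i @^-1` B i))%E.

Definition infinitely_divisible d (W : measurableType d) (P : probability W R)
    (xi : {mfun W >-> config_space R E}) : Prop :=
  forall N : nat, (0 < N)%N ->
  exists (d' : measure_display) (W' : measurableType d') (P' : probability W' R)
    (X : 'I_N -> {mfun W' >-> config_space R E})
    (S : {mfun W' >-> config_space R E}),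
    [/\ independent P' X,
        forall i j, same_law P' P' (X i) (X j),
        forall (w : W') (B : set (borel E)), measurable B ->
          (S w : config R E) B = (\sum_(i < N) (X i w : config R E) B)%E &
        same_law P P' xi S].

End Laws.

(* The topology of the complex plane, through its structure of numFieldType. *)
Notation cplx R := (R[i] : numFieldType).

Section TraceClass.
Variables (R : realType) (E : ptopologicalType).
Variable lam : {measure set (borel E) -> \bar R}.
Variable L : set (borel E).
Implicit Types f g : borel E -> R[i].

Definition sqnorm f : \bar R :=
  (\int[lam]_(x in L) ((complex.Re (f x)) ^+ 2 + (complex.Im (f x)) ^+ 2)%:E)%E.

Definition square_integrable f : Prop :=
  [/\ measurable_fun L (fun x => complex.Re (f x)),
      measurable_fun L (fun x => complex.Im (f x)) &
      (sqnorm f < +oo)%E].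

Definition cintegral f : R[i] :=
  (\int[lam]_(x in L) complex.Re (f x))%R +i* (\int[lam]_(x in L) complex.Im (f x))%R.

Definition inner f g : R[i] := cintegral (fun x => f x * (g x)^*).

Definition orthonormal (I : set nat) (phi : nat -> borel E -> R[i]) : Prop :=
  (forall k, I k -> square_integrable (phi k)) /\
  (forall k l, I k -> I l -> inner (phi k) (phi l) = (k == l)%:R).

(* T f = \sum_k a_k <f, psi_k> phi_k in L^2(L, lam); the vectors attached to
   a_k = 0 play no role, which accounts for operators of finite rank. *)
Definition singular_decomposition (T : (borel E -> R[i]) -> (borel E -> R[i]))
    (a : nat -> R) (phi psi : nat -> borel E -> R[i]) : Prop :=
  [/\ forall k, 0 <= a k,
      orthonormal [set k | 0 < a k] phi,
      orthonormal [set k | 0 < a k] psi &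
      forall f, square_integrable f ->
        (fun n : nat => sqnorm (fun x =>
           T f x - \sum_(k < n) (a k)%:C * inner f (psi k) * phi k x)) @ \oo
          --> 0%E].

Definition integral_operator (K : E -> E -> R[i]) f (x : borel E) : R[i] :=
  cintegral (fun y => K x y * f y).

(* The convention fixing K on the diagonal: N is a null set of points, not of
   pairs, so K x x is the sum of the series for almost every x. *)
Definition canonical_kernel (K : E -> E -> R[i])
    (a : nat -> R) (phi psi : nat -> borel E -> R[i]) : Prop :=
  exists2 N : set (borel E), lam.-negligible N &
    forall x y : E, (L `\` N) x -> (L `\` N) y ->
      (fun n : nat => \sum_(k < n) (a k)%:C * phi k x * (psi k y)^* : cplx R) @ \oo
        --> (K x y : cplx R).

(* A trace class operator is one with summable singular values. *)
Definition trace_class_kernel (K : E -> E -> R[i]) : Prop :=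
  exists (a : nat -> R) (phi psi : nat -> borel E -> R[i]),
    [/\ singular_decomposition (integral_operator K) a phi psi,
        cvgn (series a) &
        canonical_kernel K a phi psi].

End TraceClass.

Definition locally_trace_class (R : realType) (E : ptopologicalType)
    (lam : {measure set (borel E) -> \bar R}) (K : E -> E -> R[i]) : Prop :=
  forall L : set E, compact L -> trace_class_kernel lam L K.

Section Correlation.
Variables (R : realType) (E : ptopologicalType).

Definition cons_pair (n : nat) (p : borel E * n.-tuple (borel E)) :
  n.+1.-tuple (borel E) := [tuple of p.1 :: p.2].

(* Only a set function here; a measure as soon as lam is sigma-finite, as is
   every Radon measure on a locally compact Polish space. *)
Fixpoint power_measure (lam : set (borel E) -> \bar R) (n : nat) :
    set (n.-tuple (borel E)) -> \bar R :=
  if n is m.+1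
  then pushforward (lam \x @power_measure lam m)%E (@cons_pair m)
  else dirac ([tuple] : 0.-tuple (borel E)).
Local Arguments power_measure lam n _ : clear implicits.

Definition falling (a : R) (k : nat) : R := \prod_(i < k) (a - i%:R).

(* tagnat.sig1 sends a coordinate of the product of the L_i ^ (m i), taken in
   order, to the index i of its block. *)
Definition block_set (d : nat) (L : 'I_d -> set (borel E)) (m : 'I_d -> nat) :
    set ((\sum_(i < d) m i)%N.-tuple (borel E)) :=
  [set x | forall j, L (tagnat.sig1 j) (tnth x j)].
Local Arguments block_set {d} L m _.

Definition correlation_functions d (W : measurableType d) (P : probability W R)
    (lam : {measure set (borel E) -> \bar R}) (xi : W -> config R E)
    (rho : forall n : nat, n.-tuple (borel E) -> R) : Prop :=
  (forall n, measurable_fun setT (rho n)) /\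
  (forall n x, 0 <= rho n x) /\
  forall (r : nat) (L : 'I_r -> set (borel E)) (m : 'I_r -> nat),
    (forall i, measurable (L i)) ->
    (forall i, precompact (L i : set E)) ->
    trivIset setT L ->
    (forall i, (0 < m i)%N) ->
    (\int[P]_w (\prod_(i < r) falling (fine (xi w (L i))) (m i))%:E =
     \int[power_measure lam (\sum_(i < r) m i)]_(x in block_set L m)
       (rho _ x)%:E)%E.

(* rho_n is only determined almost everywhere, and so is the determinant. *)
Definition alpha_determinantal d (W : measurableType d) (P : probability W R)
    (lam : {measure set (borel E) -> \bar R}) (alpha : R) (K : E -> E -> R[i])
    (xi : {mfun W >-> config_space R E}) : Prop :=
  exists rho : forall n : nat, n.-tuple (borel E) -> R,
    correlation_functions P lam xi rho /\
    forall n : nat, \forall x \ae power_measure lam n,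
      (rho n x)%:C =
      det_alpha alpha%:C (\matrix_(i < n, j < n) K (tnth x i) (tnth x j)).

End Correlation.

Arguments power_measure {R E} lam n _.
Arguments block_set {E d} L m _.

(* Main.v *)
From HB Require Import structures.
Require Import Defs.
From mathcomp Require Import all_boot all_order all_algebra all_fingroup.
From mathcomp Require Import all_classical all_reals all_analysis.
From mathcomp Require Import measurable_realfun complex ring lra.

(** An infinitely divisible process cannot repel its own points, whereas a
    negative [alpha] forces repulsion at short distance; two moments of the
    number of points in one well chosen compact set already see the conflict.

    Let [X] be the number of points of [xi] in a compact set [C].  If [xi] is a
    sum of [N] independent copies of a process, [X] is a sum of [N] independent
    natural numbers [X_i] of the same law, and [X * (X - 1)] is at least the sum
    of the products [X_i * X_j] over [i <> j].  So the second factorial moment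
    of [X] is at least [(1 - 1 / N)] times the square of its mean
    ([infinitely_divisible_second_moment]), for every [N].

    On the other side the mean is the integral of [K x x] over [C], and the
    second factorial moment is the integral over [C * C] of
    [K x x * K y y + alpha * (K x y * K y x)].  Should [K x y * K y x] have a
    real part bounded below by a positive constant on [C * C], the moment would
    stay below the square of the mean by a fixed amount
    ([power_measure2_cube_le]), which is absurd for large [N].

    [K] is not assumed Hermitian, so that product has no sign in general, and
    [C] has to be found.  The set where [K x x] is real and exceeds some
    [delta > 0] is not null, because [xi] has points.  A trace class kernel is a
    series of products of functions of one variable, whose tail is small
    uniformly on a set of positive measure; measurable functions being nearly
    constant on suitable sets of positive measure, so is [K]
    ([trace_class_nearly_constant]).  On such a set [K x y] is close to
    [K x x >= delta] and the product is close to a positive square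
    ([kernel_positive_product]); inner regularity replaces the set by a compact
    one.

    Working with the mass of a compact set as a random variable requires that
    it be measurable for the Borel sets of the vague topology, which is
    [measurable_config_mass]. *)

Set Implicit Arguments.
Unset Strict Implicit.
Unset Printing Implicit Defensive.
Import Order.TTheory GRing.Theory Num.Theory.
Import numFieldNormedType.Exports.
Local Open Scope classical_set_scope.
Local Open Scope ring_scope.

(** * Sets of positive measure *)

Section PositiveMeasure.
Context d (T : measurableType d) (R : realType).
Variable mu : {measure set T -> \bar R}.

Lemma positive_measure_piece (A : set T) (F : nat -> set T) :
  measurable A -> (forall n, measurable (F n)) -> A `<=` \bigcup_n F n ->
  (0 < mu A)%E -> exists n, (0 < mu (A `&` F n))%E.
Proof.
move=> mA mF AF A0; apply: contrapT => /forallNP nF.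
suff : mu.-negligible A by move/(measure_negligible mA) => A0'; rewrite A0' ltxx in A0.
apply: (@negligibleS _ _ _ _ (\bigcup_n (A `&` F n))).
  by move=> x Ax; have [n _ Fx] := AF x Ax; exists n.
apply: negligible_bigcup => n; apply/negligibleP; first exact: measurableI.
by apply/eqP; rewrite eq_le measure_ge0 andbT leNgt; apply/negP/nF.
Qed.

Lemma positive_measure_avoid (A N : set T) :
  measurable A -> mu.-negligible N -> (0 < mu A)%E ->
  exists B, [/\ measurable B, B `<=` A, (forall x, B x -> ~ N x) & (0 < mu B)%E].
Proof.
move=> mA [M [mM M0 NM]] A0; exists (A `\` M); split.
- exact: measurableD.
- by move=> x [].
- by move=> x [_ nMx] /NM.
- rewrite ltNge; apply/negP => AM0.
  suff : mu.-negligible A by move/(measure_negligible mA) => A0'; rewrite A0' ltxx in A0.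
  apply: (@negligibleS _ _ _ _ ((A `\` M) `|` M)).
    by move=> x Ax; have [Mx|nMx] := pselect (M x); [right|left].
  apply: negligibleU; last by exists M; split.
  apply/negligibleP; first exact: measurableD.
  by apply/eqP; rewrite eq_le measure_ge0 andbT.
Qed.

Lemma positive_measure_ex (A : set T) : (0 < mu A)%E -> exists x, A x.
Proof. by move=> A0; apply/set0P/eqP => A_eq; rewrite A_eq measure0 ltxx in A0. Qed.

Lemma measurable_level (r : T -> R) (c : R) :
  measurable_fun setT r -> measurable [set x | c <= r x].
Proof.
move=> mr; rewrite -[X in measurable X]setTI.
have -> : [set x | c <= r x] = r @^-1` `[c, +oo[%classic.
  by apply/seteqP; split => x /=; rewrite in_itv /= andbT.
exact: mr.
Qed.

Lemma positive_integral_level (L : set T) (r : T -> R) :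
  measurable L -> measurable_fun setT r -> (forall x, 0 <= r x) ->
  (0 < \int[mu]_(x in L) (r x)%:E)%E ->
  exists2 c : R, 0 < c & (0 < mu (L `&` [set x | (c <= r x)%R]))%E.
Proof.
move=> mL mr r0 int_r.
pose A : set T := L `&` [set x | 0 < r x].
have mA : measurable A.
  apply: measurableI => //; rewrite -[X in measurable X]setTI.
  have -> : [set x | 0 < r x] = r @^-1` `]0, +oo[%classic.
    by apply/seteqP; split => x /=; rewrite in_itv /= andbT.
  exact: mr.
pose F n : set T := L `&` [set x | n.+1%:R^-1 <= r x].
have mF n : measurable (F n) by apply: measurableI => //; exact: measurable_level.
have AF : A `<=` \bigcup_n F n.
  move=> x [Lx rx].
  have [n _ /(_ n (leqnn n)) rn] := near_infty_natSinv_lt (PosNum rx).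
  by exists n => //; split => //; exact: ltW.
have A0 : (0 < mu A)%E.
  rewrite lt0e measure_ge0 andbT; apply: contraTN int_r => /eqP A0.
  rewrite (@ge0_ae_eq_integral _ _ _ _ _ _ (cst 0%E)) ?integral0 ?ltxx //.
  - by apply/measurable_EFinP; exact: measurable_funTS.
  - by move=> x _; rewrite lee_fin.
  exists A; split => // x /= /not_implyP[Lx /eqP]; rewrite eqe => rx.
  by split => //=; rewrite lt0r rx r0.
have [n An0] := positive_measure_piece mA mF AF A0.
exists n.+1%:R^-1; first by rewrite invr_gt0.
apply: (lt_le_trans An0); apply: le_measure; rewrite ?inE; last by move=> x [].
  exact: measurableI.
exact: (mF n).
Qed.

Variable L : set T.

(** A measure-theoretic stand-in for continuity on the diagonal: like continuity
    it is stable under sums, products and dominated series, but measurable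
    functions of one variable have it. *)
Definition nearly_constant (k : T -> T -> R) : Prop :=
  forall (A : set T) (e : R), measurable A -> A `<=` L -> (0 < mu A)%E -> 0 < e ->
  exists B : set T, [/\ measurable B, B `<=` A, (0 < mu B)%E &
    forall x y x' y', B x -> B y -> B x' -> B y' -> `|k x y - k x' y'| <= e].

Lemma nearly_constant_cst (c : R) : nearly_constant (fun _ _ => c).
Proof.
move=> A e mA _ A0 e0; exists A; split => // x y x' y' _ _ _ _.
by rewrite subrr normr0 ltW.
Qed.

(** The preimages of countably many intervals of length [e] cover [A], so one of
    them meets [A] in positive measure. *)
Lemma measurable_small_oscillation (u : T -> R) (A : set T) (e : R) :
  measurable_fun L u -> measurable L ->
  measurable A -> A `<=` L -> (0 < mu A)%E -> 0 < e ->
  exists B : set T, [/\ measurable B, B `<=` A, (0 < mu B)%E &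
    forall x y, B x -> B y -> `|u x - u y| <= e].
Proof.
move=> mu_ mL mA AL A0 e0.
pose I n := if unpickle n is Some z then `[z%:~R * e, (z + 1)%:~R * e]%classic
            else set0 : set R.
have mI n : measurable (I n) by rewrite /I; case: unpickle.
have mAu : measurable_fun A u by exact: measurable_funS mu_.
have [||n An0] := positive_measure_piece mA (F := fun n => A `&` u @^-1` I n) _ _ A0.
- by move=> n; exact: mAu.
- move=> x Ax; exists (pickle (Num.floor (u x / e))) => //; split => //.
  rewrite /I pickleK /= in_itv /= -ler_pdivlMr // Num.Theory.ge_floor /=.
  by rewrite -ler_pdivrMr // ltW // Num.Theory.lt_succ_floor.
exists (A `&` (A `&` u @^-1` I n)); split; last 1 first.
- move=> x y [_ [_ /=]] + [_ [_ /=]]; rewrite /I; case: unpickle => // z /=.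
  rewrite !in_itv /= => /andP[x1 x2] /andP[y1 y2].
  rewrite intrD mulrDl mul1r in x2 y2.
  by rewrite ler_norml; apply/andP; split; lra.
- by apply: measurableI => //; exact: mAu.
- by move=> x [].
- exact: An0.
Qed.

Lemma nearly_constant_fst (u : T -> R) :
  measurable L -> measurable_fun L u -> nearly_constant (fun x _ => u x).
Proof.
move=> mL mu_ A e mA AL A0 e0.
have [B [mB BA B0 uB]] := measurable_small_oscillation mu_ mL mA AL A0 e0.
by exists B; split => // x y x' y' Bx _ Bx' _; exact: uB.
Qed.

Lemma nearly_constant_snd (u : T -> R) :
  measurable L -> measurable_fun L u -> nearly_constant (fun _ y => u y).
Proof.
move=> mL mu_ A e mA AL A0 e0.
have [B [mB BA B0 uB]] := measurable_small_oscillation mu_ mL mA AL A0 e0.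
by exists B; split => // x y x' y' _ By _ By'; exact: uB.
Qed.

Lemma nearly_constant2 (k1 k2 : T -> T -> R) (A : set T) (e : R) :
  nearly_constant k1 -> nearly_constant k2 ->
  measurable A -> A `<=` L -> (0 < mu A)%E -> 0 < e ->
  exists B : set T, [/\ measurable B, B `<=` A, (0 < mu B)%E &
    forall x y x' y', B x -> B y -> B x' -> B y' ->
      `|k1 x y - k1 x' y'| <= e /\ `|k2 x y - k2 x' y'| <= e].
Proof.
move=> h1 h2 mA AL A0 e0.
have [B [mB BA B0 kB]] := h1 A e mA AL A0 e0.
have [C [mC CB C0 kC]] := h2 B e mB (subset_trans BA AL) B0 e0.
exists C; split => //; first exact: subset_trans BA.
by move=> x y x' y' Cx Cy Cx' Cy'; split; [apply: kB; exact: CB|exact: kC].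
Qed.

Lemma nearly_constantD (k1 k2 : T -> T -> R) :
  nearly_constant k1 -> nearly_constant k2 ->
  nearly_constant (fun x y => k1 x y + k2 x y).
Proof.
move=> h1 h2 A e mA AL A0 e0.
have e2 : 0 < e / 2 by rewrite divr_gt0.
have [B [mB BA B0 kB]] := nearly_constant2 h1 h2 mA AL A0 e2.
exists B; split => // x y x' y' Bx By Bx' By'.
have [] := kB x y x' y' Bx By Bx' By'; rewrite !ler_norml => /andP[? ?] /andP[? ?].
by apply/andP; split; lra.
Qed.

(** A first restriction, with tolerance one, bounds both factors; only then is
    the tolerance for the product chosen. *)
Lemma nearly_constantM (k1 k2 : T -> T -> R) :
  nearly_constant k1 -> nearly_constant k2 ->
  nearly_constant (fun x y => k1 x y * k2 x y).
Proof.
move=> h1 h2 A e mA AL A0 e0.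
have [B [mB BA B0 kB]] := nearly_constant2 h1 h2 mA AL A0 ltr01.
have [b Bb] := positive_measure_ex B0.
pose M := `|k1 b b| + `|k2 b b| + 1.
have M0 : 0 < M by rewrite /M ltr_wpDl // addr_ge0.
have e2 : 0 < e / (2 * M) by rewrite divr_gt0 // mulr_gt0.
have [C [mC CB C0 kC]] := nearly_constant2 h1 h2 mB (subset_trans BA AL) B0 e2.
exists C; split => //; first exact: subset_trans BA.
move=> x y x' y' Cx Cy Cx' Cy'.
have [k1C k2C] := kC x y x' y' Cx Cy Cx' Cy'.
have [k1x _] := kB x y b b (CB _ Cx) (CB _ Cy) Bb Bb.
have [_ k2x'] := kB x' y' b b (CB _ Cx') (CB _ Cy') Bb Bb.
have b1 : `|k1 x y| <= M.
  rewrite -[k1 x y](subrK (k1 b b)) (le_trans (ler_normD _ _)) // /M.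
  by rewrite [leLHS]addrC -addrA lerD2l (le_trans k1x) // lerDr.
have b2 : `|k2 x' y'| <= M.
  rewrite -[k2 x' y'](subrK (k2 b b)) (le_trans (ler_normD _ _)) // /M.
  by rewrite [leLHS]addrC -[leRHS]addrA -[leLHS]add0r lerD // lerD.
have -> : k1 x y * k2 x y - k1 x' y' * k2 x' y' =
  k1 x y * (k2 x y - k2 x' y') + k2 x' y' * (k1 x y - k1 x' y') by ring.
rewrite (le_trans (ler_normD _ _)) // !normrM.
have -> : e = M * (e / (2 * M)) + M * (e / (2 * M)).
  by field; rewrite gt_eqF.
by rewrite lerD // ler_pM.
Qed.

Lemma nearly_constant_sum (k : nat -> T -> T -> R) (n : nat) :
  (forall i, nearly_constant (k i)) ->
  nearly_constant (fun x y => \sum_(0 <= i < n) k i x y).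
Proof.
move=> hk; elim: n => [|n IH].
  by under eq_fun do under eq_fun do rewrite big_geq //; exact: nearly_constant_cst.
under eq_fun do under eq_fun do rewrite big_nat_recr //=.
exact: nearly_constantD.
Qed.

(** Where the series of the [s i] converges, its tails are eventually at most
    [e / 6]; some rank serves on a whole set of positive measure, and there [K]
    is uniformly close to a partial sum. *)
Lemma nearly_constant_series (k : nat -> T -> T -> R) (s : nat -> T -> R)
    (K : T -> T -> R) (N : set T) :
  measurable L -> mu.-negligible N ->
  (forall i, nearly_constant (k i)) ->
  (forall i, measurable_fun L (s i)) -> (forall i x, 0 <= s i x) ->
  (forall i x y, `|k i x y| <= s i x + s i y) ->
  (forall x, L x -> ~ N x -> cvgn (series (s ^~ x))) ->
  (forall x y, L x -> ~ N x -> L y -> ~ N y ->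
     series (fun i => k i x y) @ \oo --> K x y) ->
  nearly_constant K.
Proof.
move=> mL hN hk ms s0 ks cs cK A e mA AL A0 e0.
have [B [mB BA BN B0]] := positive_measure_avoid mA hN A0.
have BL := subset_trans BA AL.
have e6 : 0 < e / 6 by rewrite divr_gt0.
(* The points where every block of the series that starts at m is small. *)
pose F m := \bigcap_n (L `&` (fun x => \sum_(m <= i < m + n) s i x) @^-1` `]-oo, e / 6]%classic).
have mF m : measurable (F m).
  apply: bigcap_measurable => // n _.
  have : measurable_fun L (fun x => \sum_(m <= i < m + n) s i x).
    by apply: measurable_sum => i; exact: ms.
  by apply => //; exact: measurable_itv.
have BF : B `<=` \bigcup_m F m.
  move=> x Bx; have Lx := BL _ Bx; have Nx := BN _ Bx.
  have /cauchy_cvgP /cauchy_seriesP /(_ _ e6) := cs x Lx Nx.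
  move=> [[P1 P2] /= [[m1 _ Pm1] [m2 _ Pm2]] PP].
  exists (maxn m1 m2) => // n _; split => //=; rewrite in_itv /=.
  apply: le_trans (ler_norm _) _; apply: ltW; apply: (PP (_, _)); split => /=.
    by apply: Pm1; rewrite /= leq_maxl.
  by apply: Pm2; rewrite /= (leq_trans _ (leq_addr _ _)) // leq_maxr.
have [m Bm0] := positive_measure_piece mB mF BF B0.
have e3 : 0 < e / 3 by rewrite divr_gt0.
have BmL : B `&` F m `<=` L by move=> x [/BL].
have [C [mC CB C0 kC]] :=
  nearly_constant_sum m hk (measurableI _ _ mB (mF m)) BmL Bm0 e3.
exists C; split => //; first by move=> x /CB[/BA].
have close x y : C x -> C y -> `|K x y - \sum_(0 <= i < m) k i x y| <= e / 3.
  move=> /CB[Bx Fx] /CB[By Fy].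
  have h : `|series (fun i => k i x y) n - \sum_(0 <= i < m) k i x y| @[n --> \oo]
      --> `|K x y - \sum_(0 <= i < m) k i x y|.
    apply: cvg_norm; apply: cvgB; last exact: cvg_cst.
    by apply: cK; [exact: BL|exact: BN|exact: BL|exact: BN].
  rewrite -(cvg_lim _ h) //; apply: limr_le; first by apply/cvg_ex; eexists; exact: h.
  exists m => // n /= mn.
  rewrite -(subnKC mn) /series /= (big_cat_nat _ (leq_addr _ _)) //=.
  rewrite [X in `|X|]addrC addKr (le_trans (ler_norm_sum _ _ _)) //.
  apply: (@le_trans _ _ (\sum_(m <= i < m + (n - m)) (s i x + s i y))).
    by apply: ler_sum => i _; exact: ks.
  rewrite big_split /=.
  have [_ /=] := Fx (n - m)%N I; have [_ /=] := Fy (n - m)%N I.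
  by rewrite !in_itv /=; lra.
move=> x y x' y' Cx Cy Cx' Cy'.
have := kC x y x' y' Cx Cy Cx' Cy'.
have := close x y Cx Cy; have := close x' y' Cx' Cy'.
rewrite !ler_norml => /andP[? ?] /andP[? ?] /andP[? ?].
by apply/andP; split; lra.
Qed.

End PositiveMeasure.

(** * Compact sets in a locally compact Polish space *)

Lemma continuous_borel_measurable (R : realType) (T : ptopologicalType)
    (f : T -> R) : continuous f -> measurable_fun [set: borel T] (f : borel T -> R).
Proof.
move=> cf; apply: (measurability _ (RGenOInfty.measurableE R)).
move=> _ [_ [x ->] <-]; rewrite setTI; apply: sub_sigma_algebra.
by rewrite set_itvE; apply: open_comp; [move=> y _; exact: cf|exact: open_gt].
Qed.

Section MetricSpace.
Context (R : realType) (E : ptopologicalType) (dist : E -> E -> R).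
Hypothesis dist_eq0 : forall x y, dist x y = 0 <-> x = y.
Hypothesis distC : forall x y, dist x y = dist y x.
Hypothesis dist_tri : forall x y z, dist x z <= dist x y + dist y z.
Hypothesis dist_nbhs : forall (x : E) (A : set E), nbhs x A <->
  exists2 e : R, 0 < e & [set y | dist x y < e] `<=` A.

Lemma dist_ge0 x y : 0 <= dist x y.
Proof.
have : dist x x = 0 by apply/dist_eq0.
by have := dist_tri x y x; rewrite (distC y x) => + dx; rewrite dx; lra.
Qed.

Lemma nbhs_dist x e : 0 < e -> nbhs x [set y | dist x y < e].
Proof. by move=> e0; apply/dist_nbhs; exists e. Qed.

Lemma hausdorff_dist : hausdorff_space E.
Proof.
move=> p q clpq; apply/dist_eq0; apply: contrapT => /eqP pq.
have e0 : 0 < dist p q / 2 by rewrite divr_gt0 // lt_neqAle eq_sym pq dist_ge0.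
have [z [/= pz qz]] := clpq _ _ (nbhs_dist p e0) (nbhs_dist q e0).
by have := dist_tri p z q; rewrite (distC z q); lra.
Qed.

Lemma continuous_lipschitz (f : E -> R) (M : R) : 0 < M ->
  (forall x y, `|f x - f y| <= M * dist x y) -> continuous f.
Proof.
move=> M0 fM x; apply/cvgrPdist_lt => e e0.
near=> y; rewrite (le_lt_trans (fM x y)) // mulrC -ltr_pdivlMr //.
by near: y; apply: nbhs_dist; rewrite divr_gt0.
Unshelve. all: by end_near. Qed.

Section DistanceToSet.
Variable (C : set E).
Hypothesis C0 : C !=set0.

Definition dist_set x := inf [set dist x c | c in C].

Let has_lb x : has_lbound [set dist x c | c in C].
Proof. by exists 0 => _ [c _ <-]; exact: dist_ge0. Qed.

Let ne x : [set dist x c | c in C] !=set0.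
Proof. by have [c Cc] := C0; exists (dist x c); exists c. Qed.

Lemma dist_set_ge0 x : 0 <= dist_set x.
Proof. by apply: lb_le_inf => // _ [c _ <-]; exact: dist_ge0. Qed.

Lemma dist_set_le x c : C c -> dist_set x <= dist x c.
Proof. by move=> Cc; apply: ge_inf => //; exists c. Qed.

Lemma dist_set_lt x e : dist_set x < e -> exists2 c, C c & dist x c < e.
Proof.
move=> xe; have e0 : 0 < e - dist_set x by rewrite subr_gt0.
have [_ [c Cc <-] ce] := inf_adherent e0 (conj (ne x) (has_lb x)).
by exists c => //; rewrite (lt_le_trans ce) // /dist_set; lra.
Qed.

Lemma dist_set_lipschitz x y : `|dist_set x - dist_set y| <= dist x y.
Proof.
have h a b : dist_set a <= dist a b + dist_set b.
  rewrite -lerBlDl; apply: lb_le_inf => // _ [c Cc <-].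
  by rewrite lerBlDl (le_trans (dist_set_le a Cc)).
have := h x y; have := h y x; rewrite (distC y x) => h1 h2.
by rewrite ler_norml; apply/andP; split; lra.
Qed.

Definition tent (n : nat) (x : E) : R := Num.max 0 (1 - n.+1%:R * dist_set x).

Lemma tent_ge0 n x : 0 <= tent n x.
Proof. by rewrite /tent le_max lexx. Qed.

Lemma tent_le1 n x : tent n x <= 1.
Proof.
rewrite /tent ge_max ler01 /= gerBl.
by rewrite mulr_ge0 ?dist_set_ge0.
Qed.

Lemma tent_neq0 n x : tent n x != 0 -> dist_set x < n.+1%:R^-1.
Proof.
rewrite /tent; case: (ltP 0 (1 - _)); rewrite ?eqxx // subr_gt0 => h _.
by rewrite -[ltRHS]mul1r ltr_pdivlMr // mulrC.
Qed.

Lemma tent_in n x : C x -> tent n x = 1.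
Proof.
move=> Cx; have : dist_set x = 0.
  apply/eqP; rewrite eq_le dist_set_ge0 andbT (le_trans (dist_set_le x Cx)) //.
  by have -> : dist x x = 0 by apply/dist_eq0.
by rewrite /tent => ->; rewrite mulr0 subr0 max_r.
Qed.

Lemma tent_continuous n : continuous (tent n).
Proof.
apply: (@continuous_lipschitz _ n.+1%:R) => // x y.
apply: (@le_trans _ _ `|(1 - n.+1%:R * dist_set x) - (1 - n.+1%:R * dist_set y)|).
  rewrite /tent; set a := 1 - _ * dist_set x; set b := 1 - _ * dist_set y.
  case: (ltP 0 a) => ?; case: (ltP 0 b) => ?; rewrite ?ler_norml;
    have := ler_norm (a - b); have := ler_norm (- (a - b)); rewrite normrN => *;
    apply/andP; split; lra.
have -> : 1 - n.+1%:R * dist_set x - (1 - n.+1%:R * dist_set y) =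
  n.+1%:R * (dist_set y - dist_set x) by ring.
rewrite normrM ger0_norm // ler_pM2l //.
by rewrite (distC x y) dist_set_lipschitz.
Qed.

Lemma tent_cvg x : closed C -> (tent n x) @[n --> \oo] --> (\1_C x : R).
Proof.
move=> cC; rewrite indicE; have [Cx|nCx] := pselect (C x).
  rewrite mem_set //=; under eq_fun do rewrite tent_in //; exact: cvg_cst.
rewrite memNset //=.
have [e e0 eC] : exists2 e, 0 < e & [set y | dist x y < e] `<=` ~` C.
  by apply/dist_nbhs; apply: open_nbhs_nbhs; split => //; exact: closed_openC.
have de : e <= dist_set x.
  by rewrite leNgt; apply/negP => /dist_set_lt[c Cc xc]; exact: (eC c).
apply: (@cvg_near_cst _ _ _ _ \oo).
near=> n; rewrite /tent; apply/max_idPl.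
rewrite subr_le0 -ler_pdivrMl // mulr1 (le_trans _ de) // ltW //.
by near: n; exact: near_infty_natSinv_lt (PosNum e0).
Unshelve. all: by end_near. Qed.

End DistanceToSet.

Hypothesis E_lc : locally_compact [set: E].

(** Each ball of radius [1 / m.+1] around a point of the dense set that lies in
    some compact set contributes one such compact set; the enumeration of the
    pairs (radius, centre) makes the family a sequence. *)
Lemma compact_exhaustion (D : set E) : countable D -> dense D ->
  exists V : nat -> set E, [/\ forall n, compact (V n) /\ closed (V n),
    forall m n, (m <= n)%N -> V m `<=` V n & forall x : E, exists n, nbhs x (V n)].
Proof.
move=> /countable_injP[f f_inj] D_dense.
pose good i U := exists c m, [/\ D c, i = pickle (m : nat, f c),
  compact U, closed U & [set y | dist c y < m.+1%:R^-1] `<=` U].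
have /choice[U hU] : forall i : nat, exists U : set E,
    (compact U /\ closed U) /\ ((exists V, good i V) -> good i U).
  move=> i; have [[V gV]|nV] := pselect (exists V, good i V).
    exists V; split => //.
    by case: gV => c [m [_ _ cV clV _]].
  by exists set0; split => //; split; [exact: compact0|exact: closed0].
exists (fun n => \big[setU/set0]_(i < n.+1) U i); split.
- move=> n; split.
    by apply: bigsetU_compact => i _; have [[]] := hU i.
  by apply: closed_bigsetU => i _; have [[]] := hU i.
- move=> m n mn; rewrite -!bigcup_mkord => x [i /= im Ux].
  by exists i => //=; rewrite (leq_trans im).
move=> x; have [V] := @E_lc x I; rewrite withinET => xV [cV clV].
move/dist_nbhs : xV => [e e0 eV].
have [m me] : exists m : nat, m.+1%:R^-1 < e / 2.
  have e2 : 0 < e / 2 by rewrite divr_gt0.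
  by have [m _ /(_ m (leqnn m))] := near_infty_natSinv_lt (PosNum e2); exists m.
have m0 : 0 < m.+1%:R^-1 :> R by rewrite invr_gt0.
have [c [Bc Dc]] : (interior [set y | dist x y < m.+1%:R^-1] `&` D) !=set0.
  apply: D_dense; last exact: open_interior.
  by exists x; exact: nbhs_dist.
have xc : dist x c < m.+1%:R^-1 := interior_subset Bc.
exists (pickle (m, f c)).
have [_ gU] := hU (pickle (m, f c)).
have [|c' [m' [Dc' /(pcan_inj pickleK) [mm' fcc'] _ _ bU]]] := gU.
  exists V, c, m; split => // y /= cy; apply: eV => /=.
  by move: (dist_tri x c y) me xc cy; move: (_^-1) => r; lra.
have cc' : c = c' by apply: f_inj => //; rewrite inE.
rewrite -mm' -cc' in bU.
apply: (@filterS _ _ _ (U (pickle (m, f c)))).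
  by rewrite -bigcup_mkord; apply: bigcup_sup => /=.
apply/dist_nbhs; exists (m.+1%:R^-1 - dist x c); first by rewrite subr_gt0.
move=> y /= xy; apply: bU => /=.
by move: xy (dist_tri c x y); rewrite (distC c x); move: (_^-1) => r; lra.
Qed.

(** A uniform thickening of a compact set stays inside a member of the
    exhaustion; it makes the tents of small width compactly supported. *)
Lemma compact_neighbourhood (C : set E) (V : nat -> set E) : compact C ->
  (forall m n, (m <= n)%N -> V m `<=` V n) -> (forall x : E, exists n, nbhs x (V n)) ->
  exists n : nat, forall x c, C c -> dist x c < n.+1%:R^-1 -> V n x.
Proof.
move=> /compact_near_coveringP Cco V_mono V_nbhs.
have := Cco nat \oo (fun n c => forall x, dist x c < n.+1%:R^-1 -> V n x) _.
case.
  move=> c Cc; have [k /dist_nbhs[e e0 eV]] := V_nbhs c.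
  have e2 : 0 < e / 2 by rewrite divr_gt0.
  near=> c' n => /= x xc'.
  apply: (V_mono k); first by near: n; exact: nbhs_infty_ge.
  apply: eV => /=.
  have cc' : dist c c' < e / 2 by near: c'; exact: nbhs_dist.
  have ne : n.+1%:R^-1 < e / 2.
    by near: n; exact: (near_infty_natSinv_lt (PosNum e2)).
  by move: xc' ne cc' (dist_tri c c' x); rewrite (distC c' x); move: (n.+1%:R^-1) => r; lra.
by move=> n _ /(_ n (leqnn n)) h; exists n => x c Cc; exact: h.
Unshelve. all: by end_near. Qed.

End MetricSpace.

(** * Masses of compact sets as functions of the configuration *)

Lemma eval_continuous (I : Type) (K : I -> topologicalType) (i : I) :
  continuous (fun h : prod_topology K => h i).
Proof.
move=> h A Ahi.
have /cvg_sup/(_ i) sub_i := @cvg_id _ (nbhs (h : prod_topology K)).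
exact: (sub_i _ (@initial_continuous _ _ (fun f : prod_topology K => f i) h A Ahi)).
Qed.

Lemma polish_hausdorff (R : realType) (E : ptopologicalType) :
  polish R E -> hausdorff_space E.
Proof.
by move=> [_ [dist [d0 dC dtri dnbhs _]]]; exact: (hausdorff_dist d0 dC dtri dnbhs).
Qed.

Lemma polish_exhaustion (R : realType) (E : ptopologicalType) :
  polish R E -> locally_compact [set: E] ->
  exists V : nat -> set E, [/\ forall n, compact (V n) /\ closed (V n),
    forall m n, (m <= n)%N -> V m `<=` V n & forall x : E, exists n, nbhs x (V n)].
Proof.
move=> [[D cD dD] [dist [d0 dC dtri dnbhs _]]] E_lc.
exact: (compact_exhaustion dC dtri dnbhs (@E_lc) cD dD).
Qed.

Lemma exhaustion_setT (E : ptopologicalType) (V : nat -> set E) :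
  (forall x : E, exists n, nbhs x (V n)) -> \bigcup_n V n = setT.
Proof.
move=> V_nbhs; apply/seteqP; split => // x _.
by have [n /nbhs_singleton] := V_nbhs x; exists n.
Qed.

Lemma closed_borel_measurable (E : ptopologicalType) (C : set E) :
  closed C -> measurable (C : set (borel E)).
Proof.
move=> cC; rewrite -[C]setCK; apply: measurableC.
by apply: sub_sigma_algebra; exact: closed_openC.
Qed.

Lemma compact_borel_measurable (R : realType) (E : ptopologicalType) (C : set E) :
  polish R E -> compact C -> measurable (C : set (borel E)).
Proof.
move=> E_polish cC; apply: closed_borel_measurable.
by apply: compact_closed => //; exact: polish_hausdorff E_polish.
Qed.

Lemma config_compact_fin_num (R : realType) (E : ptopologicalType)
    (mu : config R E) (C : set E) : compact C -> mu C \is a fin_num.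
Proof.
have [muC _] := config_radon mu.
by move=> /muC; rewrite ge0_fin_numE.
Qed.

(** The vague topology only tests continuous functions; the indicator of a
    compact set is the pointwise limit of compactly supported tents, and the
    masses follow by dominated convergence. *)
Lemma measurable_config_mass (R : realType) (E : ptopologicalType) (C : set E) :
  polish R E -> locally_compact [set: E] -> compact C ->
  measurable_fun [set: config_space R E] (fun mu => fine ((mu : config R E) C)).
Proof.
move=> E_polish E_lc Cco.
have mC := compact_borel_measurable E_polish Cco.
have clC := compact_closed (polish_hausdorff E_polish) Cco.
have [C_eq0|/eqP/set0P C0] := pselect (C = set0).
  have -> : (fun mu : config_space R E => fine ((mu : config R E) C)) = cst 0.
    by apply/funext => mu; rewrite C_eq0 measure0.
  exact: measurable_cst.
have [V [V_cc V_mono V_nbhs]] := polish_exhaustion E_polish (@E_lc).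
case: (E_polish) => _ [dist [d0 dC dtri dnbhs _]].
have [N NV] := compact_neighbourhood dC dtri dnbhs Cco V_mono V_nbhs.
have mV : measurable (V N : set (borel E)).
  by apply: closed_borel_measurable; have [] := V_cc N.
have tentV n x : tent dist C (N + n) x != 0 -> V N x.
  move/tent_neq0 => xn; have [c Cc xc] := dist_set_lt d0 dC dtri C0 xn.
  apply: (NV x c) => //; rewrite (lt_le_trans xc) // lef_pV2 ?posrE //.
  by rewrite ler_nat ltnS leq_addr.
have tent_test n : continuous (tent dist C (N + n)) /\
    compact (closure [set x | tent dist C (N + n) x != 0]).
  split; first exact: (tent_continuous d0 dC dtri dnbhs).
  rewrite -precompactE; exists (V N); last exact: V_cc.
  by move=> x /= /tentV.
pose g n : test_function R E := exist _ _ (tent_test n).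
apply: (@measurable_fun_cvg _ _ _ _ (fun n (mu : config_space R E) =>
  @vague_eval R E mu (g n))).
  move=> n; apply: (@continuous_borel_measurable R (vague_config R E)) => mu.
  apply: (@continuous_comp (vague_config R E) _ _ (@vague_eval R E)
    (fun h : prod_topology (fun _ : test_function R E => R) => h (g n))).
    exact: initial_continuous.
  exact: eval_continuous.
move=> mu _; rewrite /vague_eval /=.
have muV := config_compact_fin_num mu (V_cc N).1.
have m_tent n : measurable_fun [set: borel E] (fun x => (tent dist C (N + n) x)%:E).
  apply/measurable_EFinP; apply: continuous_borel_measurable.
  exact: (tent_continuous d0 dC dtri dnbhs).
have [] := @dominated_convergence _ (borel E) R (config_measure mu) setT measurableT
  (fun n x => (tent dist C (N + n) x)%:E) (fun x => (\1_C x)%:E)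
  (fun x => (\1_(V N) x)%:E) m_tent.
- by apply/measurable_EFinP; exact: measurable_indic.
- apply: aeW => x _; apply: cvg_EFin; first exact: nearW.
  have := tent_cvg d0 dC dtri dnbhs C0 (x := x) clC.
  by rewrite -(cvg_shiftn N); under eq_fun do rewrite addnC.
- apply/integrableP; split; first by apply/measurable_EFinP; exact: measurable_indic.
  under eq_integral do rewrite gee0_abs ?lee_fin //.
  by rewrite integral_indic // setIT ltey_eq muV.
- apply: aeW => x n _; rewrite gee0_abs ?lee_fin ?tent_ge0 // indicE.
  have [xV|xV] := pselect (V N x); first by rewrite mem_set // tent_le1.
  rewrite memNset //=; have [-> //|/tentV //] := eqVneq (tent dist C (N + n) x) 0.
move=> _ _; rewrite integral_indic // setIT => h.
by apply: fine_cvg; rewrite fineK // config_compact_fin_num.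
Qed.

(** * Powers of the reference measure *)

Section SigmaFiniteCopy.
Context d (T : measurableType d) (R : realType) (mu : {measure set T -> \bar R}).
Hypothesis mu_sf : sigma_finite setT mu.

(** The proof [mu_sf] is an argument so that the sigma-finite structure can be
    attached to this copy of [mu]. *)
Definition sigma_finite_copy : set T -> \bar R := let _ := mu_sf in mu.

HB.instance Definition _ := Measure.on sigma_finite_copy.
HB.instance Definition _ := Measure_isSigmaFinite.Build _ _ _ sigma_finite_copy mu_sf.

End SigmaFiniteCopy.

Lemma pushforward_measure d1 d2 (T1 : measurableType d1) (T2 : measurableType d2)
    (R : realType) (m : {measure set T1 -> \bar R}) (f : T1 -> T2) :
  measurable_fun setT f ->
  exists mu : {measure set T2 -> \bar R}, mu = pushforward m f :> (set _ -> \bar R).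
Proof. by move=> mf; unshelve eexists (pushforward m f : {measure set _ -> \bar R}). Qed.

Section PowerMeasure.
Context (R : realType) (E : ptopologicalType).
Variable lam : {sigma_finite_measure set (borel E) -> \bar R}.

Lemma measurable_cons_pair n : measurable_fun [set: borel E * n.-tuple (borel E)]
  (@cons_pair E n).
Proof. exact: (measurable_cons measurable_fst measurable_snd). Qed.

(** [power_measure] is only built as a set function; integration theory applies
    to it through an equal genuine measure. *)
Lemma power_measure_sigma_finite n :
  exists m : {sigma_finite_measure set (n.-tuple (borel E)) -> \bar R},
    power_measure lam n = m :> (set _ -> \bar R).
Proof.
elim: n => [|n [m IH]]; first by exists (dirac ([tuple] : 0.-tuple (borel E))).
have [muM muME] := pushforward_measure (lam \x m)%E (@measurable_cons_pair n).
have mu_sf : sigma_finite setT muM.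
  have /sigma_finiteP[F [TF ndF Foo]] := sigma_finiteT lam.
  have /sigma_finiteP[G [TG ndG Goo]] := sigma_finiteT m.
  exists (fun k => [set t | F k (thead t) /\ G k [tuple of behead t]]).
    apply/seteqP; split => // t _.
    have : (\bigcup_k F k) (thead t) by rewrite -TF.
    have : (\bigcup_k G k) [tuple of behead t] by rewrite -TG.
    move=> [k _ Gk] [l _ Fl]; exists (maxn k l) => //; split => /=.
      by apply: (subsetPset _ _ (ndF _ _ (leq_maxr k l))).
    by apply: (subsetPset _ _ (ndG _ _ (leq_maxl k l))).
  move=> k; have [mF Fk] := Foo k; have [mG Gk] := Goo k; split.
    apply: measurableI.
      rewrite -[X in measurable X]setTI.
      exact: (measurable_tnth (@ord0 n) measurableT mF).
    rewrite -[X in measurable X]setTI.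
    exact: (measurable_behead measurableT mG).
  rewrite muME /pushforward.
  have -> : @cons_pair E n @^-1` [set t | F k (thead t) /\ G k [tuple of behead t]] =
      F k `*` G k.
    apply/seteqP; split => -[x t] /=; rewrite /cons_pair /= theadE;
      by (have -> : [tuple of behead [tuple of x :: t]] = t by exact: val_inj).
  have FG : ((lam \x m)%E (F k `*` G k) < +oo)%E.
    by rewrite product_measure1E // lte_mul_pinfty // ge0_fin_numE.
  exact: FG.
by exists (sigma_finite_copy mu_sf); rewrite /= IH -muME.
Qed.

Lemma power_measure_integralS n (F : n.+1.-tuple (borel E) -> \bar R) :
  measurable_fun setT F -> (forall t, 0 <= F t)%E ->
  (\int[power_measure lam n.+1]_t F t =
   \int[lam]_x \int[power_measure lam n]_t F (cons_pair (x, t)))%E.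
Proof.
move=> mF F0; have [m mE] := power_measure_sigma_finite n.
rewrite /= mE (ge0_integral_pushforward (@measurable_cons_pair n)) //.
rewrite preimage_setT (fubini_tonelli1 (F \o @cons_pair E n)) //.
  by apply: measurableT_comp => //; exact: measurable_cons_pair.
by move=> z; exact: F0.
Qed.

Lemma power_measure_integral1 (F : 1.-tuple (borel E) -> \bar R) :
  measurable_fun setT F -> (forall t, 0 <= F t)%E ->
  (\int[power_measure lam 1]_t F t = \int[lam]_x F [tuple x])%E.
Proof.
move=> mF F0; rewrite power_measure_integralS //.
apply: eq_integral => x _; rewrite /= integral_dirac //; last first.
  apply: measurableT_comp => //.
  exact: (measurable_fun_pair2 x (@measurable_cons_pair 0)).
by rewrite diracT mul1e /cons_pair /=; congr F; exact: val_inj.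
Qed.

Lemma power_measure_integral2 (F : 2.-tuple (borel E) -> \bar R) :
  measurable_fun setT F -> (forall t, 0 <= F t)%E ->
  (\int[power_measure lam 2]_t F t = \int[lam]_x \int[lam]_y F [tuple x; y])%E.
Proof.
move=> mF F0; rewrite power_measure_integralS //.
apply: eq_integral => x _; rewrite power_measure_integral1 //.
apply: measurableT_comp => //.
exact: (measurable_fun_pair2 x (@measurable_cons_pair 1)).
Qed.

Lemma power_measure1_ae (Q : borel E -> Prop) :
  (\forall t \ae power_measure lam 1, Q (tnth t ord0)) -> {ae lam, forall x, Q x}.
Proof.
move=> [B [mB B0 QB]]; have [m mE] := power_measure_sigma_finite 1.
pose u x : 1.-tuple (borel E) := [tuple x].
have mu_u : measurable_fun setT u.
  apply/measurable_fun_tnthP => i; rewrite ord1; exact: measurable_id.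
exists (u @^-1` B); split.
- by rewrite -[X in measurable X]setTI; exact: mu_u.
- have mB1 : measurable_fun setT (fun t => (\1_B t)%:E : \bar R).
    by apply/measurable_EFinP; exact: measurable_indic.
  have mB0 : m B = 0%E by rewrite -mE.
  have : (\int[power_measure lam 1]_t (\1_B t)%:E = 0)%E.
    by rewrite mE integral_indic // setIT; exact: mB0.
  rewrite power_measure_integral1 //.
  rewrite (eq_integral (fun x => (\1_(u @^-1` B) x)%:E)); last first.
    by move=> x _; rewrite !indicE; congr (_%:R%:E); apply/idP/idP; rewrite !inE.
  rewrite integral_indic // ?setIT //; last first.
    by rewrite -[X in measurable X]setTI; exact: mu_u.
- by move=> x nQ; apply: QB => /=; rewrite (tnth_nth x).
Qed.

End PowerMeasure.

(** * Correlation functions on a cube *)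

Lemma measurable_EFin_restrict d (T : measurableType d) (R : realType) (D : set T)
    (F : T -> R) : measurable D -> measurable_fun setT F ->
  measurable_fun setT ((fun x => (F x)%:E) \_ D).
Proof.
move=> mD mF; apply/(@measurable_restrictT _ _ _ _ _ (fun x => (F x)%:E) mD).
by apply/measurable_EFinP; exact: measurable_funTS.
Qed.

Section Correlations.
Context (R : realType) (E : ptopologicalType).
Variable lam : {sigma_finite_measure set (borel E) -> \bar R}.
Variable C : set (borel E).
Hypothesis mC : measurable C.

Definition cube n : set (n.-tuple (borel E)) := [set t | forall j, C (tnth t j)].
Arguments cube n : clear implicits.

Lemma measurable_cube n : measurable (cube n).
Proof.
have -> : cube n = \bigcap_i (if insub i is Some j
    then (fun t : n.-tuple (borel E) => tnth t j) @^-1` C else setT).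
  apply/seteqP; split => t /= tC.
    by move=> i /= _; case: insubP => //= j _ _; exact: tC.
  by move=> j; have := tC j I; rewrite /= valK.
apply: bigcapT_measurable => i; case: insubP => // j _ _.
by rewrite -[X in measurable X]setTI; exact: (measurable_tnth j measurableT mC).
Qed.

Lemma power_measure_mkcond n (D : set (n.-tuple (borel E))) F :
  (\int[power_measure lam n]_(t in D) F t = \int[power_measure lam n]_t (F \_ D) t)%E.
Proof. by rewrite /integral patch_setT. Qed.

Lemma power_measure1_cube (u : borel E -> R) :
  measurable_fun setT u -> (forall x, 0 <= u x) ->
  (\int[power_measure lam 1]_(t in cube 1) (u (tnth t ord0))%:E =
   \int[lam]_(x in C) (u x)%:E)%E.
Proof.
move=> mu_ u0; rewrite power_measure_mkcond [RHS]integral_mkcond.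
rewrite power_measure_integral1.
- apply: eq_integral => x _; rewrite !patchE.
  have -> // : ([tuple x] \in cube 1) = (x \in C).
  apply/idP/idP; rewrite !inE => xC; first exact: (xC ord0).
  by move=> j; rewrite ord1.
- apply: measurable_EFin_restrict; first exact: measurable_cube.
  apply: measurableT_comp => //.
  exact: (measurable_tnth (@ord0 0)).
- by move=> t; rewrite patchE; case: ifP => // _; rewrite lee_fin.
Qed.

Lemma power_measure2_cube (u : borel E -> R) :
  measurable_fun setT u -> (forall x, 0 <= u x) ->
  (\int[power_measure lam 2]_(t in cube 2) (u (tnth t ord0) * u (tnth t ord_max))%:E =
   \int[lam]_(x in C) (u x)%:E * \int[lam]_(x in C) (u x)%:E)%E.
Proof.
move=> mu_ u0; rewrite power_measure_mkcond [X in (X * _)%E]integral_mkcond.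
have muC : measurable_fun setT ((fun x => (u x)%:E) \_ C).
  exact: measurable_EFin_restrict.
have uC0 x : (0 <= ((fun x => (u x)%:E) \_ C) x)%E.
  by rewrite patchE; case: ifP => // _; rewrite lee_fin.
rewrite power_measure_integral2.
- rewrite -ge0_integralZr //; last first.
    by apply: integral_ge0 => x _; rewrite lee_fin.
  apply: eq_integral => x _.
  rewrite [in RHS]integral_mkcond -ge0_integralZl //.
  apply: eq_integral => y _; rewrite !patchE.
  have -> : ([tuple x; y] \in cube 2) = (x \in C) && (y \in C).
    apply/idP/andP; rewrite !inE.
      by move=> xyC; split; [exact: (xyC ord0)|exact: (xyC ord_max)].
    by move=> [xC yC] [[|[|]]].
  by case: (x \in C); case: (y \in C); rewrite /= ?mule0 ?mul0e ?EFinM.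
- apply: measurable_EFin_restrict; first exact: measurable_cube.
  apply: measurable_funM; apply: measurableT_comp => //.
    exact: (measurable_tnth (@ord0 1)).
  exact: (measurable_tnth (@ord_max 1)).
- by move=> t; rewrite patchE; case: ifP => // _; rewrite lee_fin mulr_ge0.
Qed.

(** A gap of [c ^+ 2] under the product [u x * u y] integrates over the square of
    [C] to a gap of the square of [c * lam C]; this is how repulsion between two
    points lowers the second factorial moment. *)
Lemma power_measure2_cube_le (u : borel E -> R) (v : 2.-tuple (borel E) -> R) (c : R) :
  measurable_fun setT u -> (forall x, 0 <= u x) ->
  measurable_fun setT v -> (forall t, 0 <= v t) -> 0 <= c ->
  (\forall t \ae power_measure lam 2,
     cube 2 t -> v t + c ^+ 2 <= u (tnth t ord0) * u (tnth t ord_max)) ->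
  (\int[power_measure lam 2]_(t in cube 2) (v t)%:E +
     (c%:E * lam C) * (c%:E * lam C) <=
   \int[lam]_(x in C) (u x)%:E * \int[lam]_(x in C) (u x)%:E)%E.
Proof.
move=> mu_ u0 mv v0 c0 vu.
rewrite -power_measure2_cube //.
have -> : (c%:E * lam C = \int[lam]_(x in C) (cst c x)%:E)%E.
  by rewrite -(integral_cst lam mC c%:E).
rewrite -(@power_measure2_cube (cst c)) //.
move: vu; have [m ->] := power_measure_sigma_finite lam 2 => vu.
have mcube : measurable (cube 2) by exact: measurable_cube.
rewrite -ge0_integralD //=; last 2 first.
- by apply/measurable_EFinP; exact: measurable_funTS.
- by move=> t _; rewrite lee_fin mulr_ge0.
apply: ae_ge0_le_integral => //.
- by move=> t _; rewrite lee_fin addr_ge0 // mulr_ge0.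
- apply/measurable_EFinP; apply: measurable_funTS.
  by apply: measurable_funD => //; exact: measurable_cst.
- by move=> t _; rewrite lee_fin mulr_ge0.
- apply/measurable_EFinP; apply: measurable_funTS.
  apply: measurable_funM; apply: measurableT_comp => //.
    exact: (measurable_tnth (@ord0 1)).
  exact: (measurable_tnth (@ord_max 1)).
- by move=> t _; rewrite lee_fin.
Qed.

(** The case of a single block; its dimension [\sum_(i < 1) n] is only
    propositionally equal to [n]. *)
Lemma correlation_falling d (W : measurableType d) (P : probability W R)
    (xi : W -> config R E) (rho : forall n : nat, n.-tuple (borel E) -> R) (n : nat) :
  correlation_functions P lam xi rho -> compact (C : set E) -> closed (C : set E) ->
  (0 < n)%N ->
  (\int[P]_w (falling (fine (xi w C)) n)%:E =
   \int[power_measure lam n]_(t in cube n) (rho n t)%:E)%E.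
Proof.
move=> [_ [_ corr]] cC clC n0.
have := corr 1%N (fun=> C) (fun=> n) (fun=> mC).
have pC : precompact (C : set E) by exists C.
have triv : trivIset setT (fun _ : 'I_1 => C).
  by move=> i j _ _ _; rewrite (ord1 i) (ord1 j).
move=> /(_ (fun=> pC) triv (fun=> n0)).
under eq_integral do rewrite big_ord1.
move=> ->; rewrite /block_set.
have : (\sum_(i < 1) n = n)%N by rewrite big_ord1.
by move: (\sum_(i < 1) n)%N => N ->.
Qed.

End Correlations.

(** * Second factorial moments of infinitely divisible processes *)

Lemma falling2 (R : realType) (a : R) : falling a 2 = a * (a - 1).
Proof. by rewrite /falling !big_ord_recr big_ord0 /= mul1r subr0. Qed.

Lemma measurable_falling2 d (T : measurableType d) (R : realType) (f : T -> R) :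
  measurable_fun setT f -> measurable_fun setT (fun x => falling (f x) 2).
Proof.
move=> mf; have -> : (fun x => falling (f x) 2) = (fun x => f x * (f x - 1)).
  by apply/funext => x; rewrite falling2.
by apply: measurable_funM => //; apply: measurable_funB.
Qed.

Section Moments.
Context (R : realType) (E : ptopologicalType).

Lemma same_law_integral d1 d2 (W1 : measurableType d1) (W2 : measurableType d2)
    (P1 : probability W1 R) (P2 : probability W2 R)
    (X1 : {mfun W1 >-> config_space R E}) (X2 : {mfun W2 >-> config_space R E})
    (g : config_space R E -> \bar R) :
  same_law P1 P2 X1 X2 -> measurable_fun setT g -> (forall mu, 0 <= g mu)%E ->
  (\int[P1]_w g (X1 w) = \int[P2]_w g (X2 w))%E.
Proof.
move=> law mg g0.
have <- := ge0_integral_distribution X1 mg g0.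
have <- := ge0_integral_distribution X2 mg g0.
by apply: eq_measure_integral => B mB _; exact: law.
Qed.

(** Independence makes the joint law of two of the configurations agree with the
    product law on rectangles, hence everywhere, and Tonelli separates the
    integrals. *)
Lemma independent_product d (W : measurableType d) (P : probability W R) (N : nat)
    (X : 'I_N -> {mfun W >-> config_space R E}) (i j : 'I_N)
    (g : config_space R E -> R) :
  independent P X -> i != j -> measurable_fun setT g -> (forall mu, 0 <= g mu) ->
  (\int[P]_w (g (X i w) * g (X j w))%:E =
   \int[P]_w (g (X i w))%:E * \int[P]_w (g (X j w))%:E)%E.
Proof.
move=> indep ij mg g0.
have mXX : measurable_fun setT (fun w => (X i w, X j w)) by exact/measurable_fun_pairP.
have [law lawE] := pushforward_measure P mXX.
have mEg : measurable_fun setT (fun mu => (g mu)%:E) by exact/measurable_EFinP.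
have Eg0 mu : (0 <= (g mu)%:E)%E by rewrite lee_fin.
have law_prod B : measurable B ->
    (distribution P (X i) \x distribution P (X j))%E B = law B.
  apply: product_measure_unique => A1 A2 mA1 mA2.
  rewrite lawE /pushforward.
  (* The full sample space for the remaining indices. *)
  pose A k := if k == i then A1 else if k == j then A2 else setT.
  have mA k : measurable (A k) by rewrite /A; case: ifP => // _; case: ifP.
  have := indep A mA.
  have -> : \bigcap_(k in [set: 'I_N]) (X k @^-1` A k) =
      (fun w => (X i w, X j w)) @^-1` (A1 `*` A2).
    apply/seteqP; split => w /=.
      move=> h; split; first by have := h i I; rewrite /A eqxx.
      by have := h j I; rewrite /= /A eqxx eq_sym (negbTE ij).
    by move=> [h1 h2] k _ /=; rewrite /A; case: eqP => [->//|_]; case: eqP => [->|].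
  move=> h; transitivity (\prod_(k < N) P (X k @^-1` A k))%E; first exact: h.
  rewrite (bigD1 i) //= (bigD1 j) /=; last by rewrite eq_sym.
  rewrite big1 ?mule1; last first.
    move=> k /andP[ki kj]; rewrite /A (negbTE ki) (negbTE kj) preimage_setT.
    exact: probability_setT.
  by rewrite /A !eqxx eq_sym (negbTE ij).
transitivity (\int[law]_z ((g z.1) * (g z.2))%:E)%E.
  rewrite lawE (ge0_integral_pushforward mXX) ?preimage_setT //.
    apply/measurable_EFinP; apply: measurable_funM; exact: measurableT_comp.
  by move=> z _; rewrite lee_fin mulr_ge0.
transitivity (\int[(distribution P (X i) \x distribution P (X j))%E]_z
    ((g z.1) * (g z.2))%:E)%E.
  by apply: eq_measure_integral => B mB _; exact: (esym (law_prod B mB)).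
rewrite fubini_tonelli1 /=; last 2 first.
- apply/measurable_EFinP; apply: measurable_funM; exact: measurableT_comp.
- by move=> z; rewrite lee_fin mulr_ge0.
rewrite -(ge0_integral_distribution (X i) mEg Eg0).
rewrite -(ge0_integral_distribution (X j) mEg Eg0).
rewrite -ge0_integralZr //; last by exact: integral_ge0.
apply: eq_integral => mu _.
by rewrite -ge0_integralZl.
Qed.

Hypothesis E_polish : polish R E.
Hypothesis E_lc : locally_compact [set: E].
Variable C : set (borel E).
Hypothesis C_compact : compact (C : set E).

Definition mass (mu : config_space R E) : R := fine ((mu : config R E) C).

Lemma mass_natural mu : exists k : nat, mass mu = k%:R.
Proof.
have mC : measurable C by exact: (compact_borel_measurable E_polish C_compact).
have := config_compact_fin_num (mu : config R E) C_compact.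
rewrite /mass; have [->|[k ->]] // := @config_integer _ _ (mu : config R E) C mC.
by exists k.
Qed.

Lemma mass_ge0 mu : 0 <= mass mu.
Proof. by have [k ->] := mass_natural mu. Qed.

Lemma measurable_mass : measurable_fun setT mass.
Proof. exact: (measurable_config_mass E_polish (@E_lc) C_compact). Qed.

Lemma falling_mass_ge0 mu : 0 <= falling (mass mu) 2.
Proof.
rewrite falling2; have [[|k] ->] := mass_natural mu; first by rewrite mul0r.
by rewrite mulr_ge0 // subr_ge0 ler1n.
Qed.

(** Write the mass as a sum of [n.+1] independent masses of mean [m / n.+1].  The
    pairs of distinct indices contribute [n * n.+1] products of means; the
    diagonal terms [X_i * (X_i - 1)] are dropped, being nonnegative as the
    [X_i] are natural numbers. *)
Lemma infinitely_divisible_second_moment d (W : measurableType d)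
    (P : probability W R) (xi : {mfun W >-> config_space R E}) (m : R) (n : nat) :
  infinitely_divisible P xi -> (\int[P]_w (mass (xi w))%:E = m%:E)%E ->
  ((n%:R / n.+1%:R * m ^+ 2)%:E <= \int[P]_w (falling (mass (xi w)) 2)%:E)%E.
Proof.
move=> /(_ n.+1 (ltn0Sn n)) [d' [W' [P' [X [S [indep same_X sumX law]]]]]] meanE.
have mC : measurable C by exact: (compact_borel_measurable E_polish C_compact).
have mXm i : measurable_fun setT (fun w => mass (X i w)).
  by apply: measurableT_comp; [exact: measurable_mass|].
have massS w : mass (S w) = \sum_(i < n.+1) mass (X i w).
  rewrite /mass sumX // sum_fine // => i _.
  exact: config_compact_fin_num.
pose e := (\int[P']_w (mass (X ord0 w))%:E)%E.
have eE i : (\int[P']_w (mass (X i w))%:E = e)%E.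
  apply: (same_law_integral (g := fun mu => (mass mu)%:E)).
  - exact: same_X.
  - by apply/measurable_EFinP; exact: measurable_mass.
  - by move=> mu; rewrite lee_fin mass_ge0.
have e0 : (0 <= e)%E by apply: integral_ge0 => w _; rewrite lee_fin mass_ge0.
have sum_e : (\sum_(i < n.+1) e = m%:E)%E.
  rewrite -meanE (same_law_integral (g := fun mu => (mass mu)%:E) law); last 2 first.
  - by apply/measurable_EFinP; exact: measurable_mass.
  - by move=> mu; rewrite lee_fin mass_ge0.
  under [RHS]eq_integral do rewrite massS -sumEFin.
  rewrite ge0_integral_sum //.
  - by apply: eq_bigr => i _; rewrite eE.
  - by move=> i; exact/measurable_EFinP.
  - by move=> i w _; rewrite lee_fin mass_ge0.
have e_fin : e \is a fin_num.
  rewrite ge0_fin_numE // (@le_lt_trans _ _ m%:E) ?ltry // -sum_e big_ord_recl.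
  by rewrite leeDl // sume_ge0.
pose r := fine e; have er : e = r%:E by rewrite fineK.
have mr : m = n.+1%:R * r.
  move: sum_e; rewrite er sumEFin => -[<-].
  by rewrite sumr_const card_ord mulr_natl.
rewrite (same_law_integral (g := fun mu => (falling (mass mu) 2)%:E) law); last 2 first.
- by apply/measurable_EFinP; apply: measurable_falling2; exact: measurable_mass.
- by move=> mu; rewrite lee_fin falling_mass_ge0.
(* The part of X * (X - 1) that comes from pairs of distinct summands. *)
pose off w := \sum_(i < n.+1) \sum_(j < n.+1 | j != i) mass (X i w) * mass (X j w).
have mprod i j : measurable_fun setT (fun w => mass (X i w) * mass (X j w)).
  exact: measurable_funM.
have moff i : measurable_fun setT
    (fun w => \sum_(j < n.+1 | j != i) mass (X i w) * mass (X j w)).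
  under eq_fun do rewrite big_mkcond.
  by apply: measurable_sum => j; case: (j != i); [exact: mprod|exact: measurable_cst].
have -> : ((n%:R / n.+1%:R * m ^+ 2)%:E = \int[P']_w (off w)%:E)%E.
  under eq_integral do rewrite -sumEFin.
  rewrite ge0_integral_sum //; last 2 first.
  - by move=> i; apply/measurable_EFinP; exact: moff.
  - by move=> i w _; rewrite lee_fin sumr_ge0 // => j _; rewrite mulr_ge0 ?mass_ge0.
  under eq_bigr => i _.
    under eq_integral do rewrite -sumEFin -big_filter.
    rewrite ge0_integral_sum //; last 2 first.
    - by move=> j; exact/measurable_EFinP.
    - by move=> j w _; rewrite lee_fin mulr_ge0 ?mass_ge0.
    rewrite big_filter; under eq_bigr => j ji.
      rewrite (independent_product indep) //; last 3 first.
      - by rewrite eq_sym.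
      - exact: measurable_mass.
      - exact: mass_ge0.
      rewrite !eE er -EFinM.
      over.
    rewrite sumEFin sumr_const.
    have -> : #|[pred j : 'I_n.+1 | j != i]| = n.
      by have := cardC1 i; rewrite card_ord.
    over.
  rewrite sumEFin sumr_const card_ord mr; congr EFin.
  by field.
apply: ge0_le_integral => //.
- by move=> w _; rewrite lee_fin sumr_ge0 // => i _; rewrite sumr_ge0 // => j _;
    rewrite mulr_ge0 ?mass_ge0.
- by apply/measurable_EFinP; apply: measurable_sum => i; exact: moff.
- apply/measurable_EFinP; apply: measurable_falling2.
  by apply: measurableT_comp; [exact: measurable_mass|].
move=> w _; rewrite lee_fin falling2 massS.
set s := \sum_(i < _) _.
have -> : off w = s * s - \sum_(i < n.+1) mass (X i w) * mass (X i w).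
  apply/eqP; rewrite eq_sym subr_eq -big_split /= {1}/s mulr_suml; apply/eqP.
  apply: eq_bigr => i _; rewrite mulr_sumr (bigD1 i) //= addrC.
  by [].
rewrite mulrBr mulr1 lerB // /s; apply: ler_sum => i _.
have [[|k] ->] := mass_natural (X i w); first by rewrite mul0r.
by rewrite ler_peMr // ler1n.
Qed.

End Moments.

(** * Trace class kernels are nearly constant on small sets *)

Lemma ae_summable d (T : measurableType d) (R : realType)
    (mu : {measure set T -> \bar R}) (L : set T) (s : nat -> T -> R) (b : nat -> R) :
  measurable L -> (forall k, measurable_fun L (s k)) -> (forall k x, 0 <= s k x) ->
  (forall k, \int[mu]_(x in L) (s k x)%:E <= (b k)%:E)%E -> cvgn (series b) ->
  {ae mu, forall x, L x -> cvgn (series (s ^~ x))}.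
Proof.
move=> mL ms s0 sb cb.
have b0 k : 0 <= b k.
  by rewrite -lee_fin (le_trans _ (sb k)) // integral_ge0 // => x _; rewrite lee_fin.
pose F x := (\sum_(k <oo) (s k x)%:E)%E.
have mEs k : measurable_fun L (fun x => (s k x)%:E) by exact/measurable_EFinP.
have F0 x : (0 <= F x)%E by apply: nneseries_ge0 => k _ _; rewrite lee_fin.
have intF : (\int[mu]_(x in L) F x < +oo)%E.
  rewrite integral_nneseries //; last by move=> k x _; rewrite lee_fin.
  apply: (@le_lt_trans _ _ (\sum_(k <oo) (b k)%:E)%E).
    apply: lee_nneseries => k *; last exact: sb.
    by apply: integral_ge0 => x _; rewrite lee_fin.
  have -> : (\sum_(k <oo) (b k)%:E = (limn (series b))%:E)%E.
    rewrite -EFin_lim //; congr (limn _); apply/funext => n /=.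
    by rewrite /series /= sumEFin.
  exact: ltry.
have iF : mu.-integrable L F.
  apply/integrableP; split.
    by apply: ge0_emeasurable_sum => k // x _ _; rewrite lee_fin.
  by under eq_integral do rewrite gee0_abs //.
have := integrable_ae mL iF; apply: filterS => x Fx Lx.
have {Fx Lx}Fx := Fx Lx.
apply: nondecreasing_is_cvgn.
  by apply: nondecreasing_series => k _ _; exact: s0.
exists (fine (F x)) => _ [n _ <-].
rewrite -lee_fin fineK // /series /= -sumEFin.
by apply: nneseries_lim_ge => k _ _; rewrite lee_fin.
Qed.

Section TraceClassKernel.
Context (R : realType) (E : ptopologicalType).
Variable lam : {measure set (borel E) -> \bar R}.
Variable L : set (borel E).
Hypothesis mL : measurable L.

Lemma orthonormal_sqnorm (I : set nat) (phi : nat -> borel E -> R[i]) k :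
  Defs.orthonormal lam L I phi -> I k -> sqnorm lam L (phi k) = 1%E.
Proof.
move=> [/(_ k) sq /(_ k k) inn] Ik.
have [_ _ fin] := sq Ik; have := inn Ik Ik; rewrite eqxx /inner /cintegral.
move=> /(congr1 (@complex.Re R)) /=.
have -> : (\int[lam]_(x in L) complex.Re (phi k x * (phi k x)^*)%C)%R =
    fine (sqnorm lam L (phi k)).
  congr fine; apply: eq_integral => x _; congr EFin.
  by case: (phi k x) => u v /=; ring.
have : sqnorm lam L (phi k) \is a fin_num.
  rewrite ge0_fin_numE //; apply: integral_ge0 => x _.
  by rewrite lee_fin addr_ge0 // sqr_ge0.
by move=> h h1; rewrite -(fineK h) h1.
Qed.

Lemma complex_cvg_Re_Im (u : nat -> R[i]) (z : R[i]) :
  (u n : cplx R) @[n --> \oo] --> (z : cplx R) ->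
  complex.Re (u n) @[n --> \oo] --> complex.Re z /\
  complex.Im (u n) @[n --> \oo] --> complex.Im z.
Proof.
move=> /cvgrPdist_lt uz.
have near_z (e : R) : 0 < e -> \forall n \near \oo, `|z - u n| < e%:C%C.
  by move=> e0; apply: uz; rewrite ltcR.
have ReB x y : complex.Re (x - y) = complex.Re x - complex.Re y :> R by case: x y => [? ?] [].
have ImB x y : complex.Im (x - y) = complex.Im x - complex.Im y :> R by case: x y => [? ?] [].
split; apply/cvgrPdist_lt => e /near_z; apply: filterS => n h.
  by rewrite -ReB -ltcR; apply: le_lt_trans h; exact: normc_ge_Re.
rewrite -ImB -ltcR; apply: le_lt_trans h.
by rewrite normc_def lecR -sqrtr_sqr ler_wsqrtr // lerDr sqr_ge0.
Qed.

Lemma Re_sum n (F : nat -> R[i]) :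
  complex.Re (\sum_(k < n) F k) = \sum_(0 <= k < n) complex.Re (F k).
Proof.
rewrite big_mkord; apply: (big_morph (@complex.Re R)) => //.
by move=> [? ?] [? ?].
Qed.

Lemma Im_sum n (F : nat -> R[i]) :
  complex.Im (\sum_(k < n) F k) = \sum_(0 <= k < n) complex.Im (F k).
Proof.
rewrite big_mkord; apply: (big_morph (@complex.Im R)) => //.
by move=> [? ?] [? ?].
Qed.

(** By the arithmetic-geometric inequality the term of index [k] is dominated by
    [s k x + s k y], where [s k] is the singular value times the squared moduli
    of the two singular vectors.  These are normalized, so the integral of [s k]
    is twice the singular value, and summability of the singular values makes
    the series of the [s k] converge almost everywhere. *)
Lemma trace_class_nearly_constant (K : E -> E -> R[i]) :
  trace_class_kernel lam L K ->
  nearly_constant lam L (fun x y => complex.Re (K x y)) /\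
  nearly_constant lam L (fun x y => complex.Im (K x y)).
Proof.
move=> [a [phi [psi [[a0 on_phi on_psi _] cv_a [N0 N0_null K_sum]]]]].
have [sq_phi _] := on_phi; have [sq_psi _] := on_psi.
(* Only the vectors with a nonzero singular value are known to be measurable. *)
pose f k x : R[i] := if 0 < a k then phi k x else 0.
pose g k x : R[i] := if 0 < a k then psi k x else 0.
pose fr k x := complex.Re (f k x); pose fi k x := complex.Im (f k x).
pose gr k x := complex.Re (g k x); pose gi k x := complex.Im (g k x).
have mfr k : measurable_fun L (fr k).
  rewrite /fr /f; case: (boolP (0 < a k)) => ak; last exact: measurable_cst.
  by have [] := sq_phi k ak.
have mfi k : measurable_fun L (fi k).
  rewrite /fi /f; case: (boolP (0 < a k)) => ak; last exact: measurable_cst.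
  by have [] := sq_phi k ak.
have mgr k : measurable_fun L (gr k).
  rewrite /gr /g; case: (boolP (0 < a k)) => ak; last exact: measurable_cst.
  by have [] := sq_psi k ak.
have mgi k : measurable_fun L (gi k).
  rewrite /gi /g; case: (boolP (0 < a k)) => ak; last exact: measurable_cst.
  by have [] := sq_psi k ak.
pose s k x := a k * ((fr k x ^+ 2 + fi k x ^+ 2) + (gr k x ^+ 2 + gi k x ^+ 2)).
have s0 k x : 0 <= s k x by rewrite mulr_ge0 // !addr_ge0 // sqr_ge0.
have mf2 k : measurable_fun L (fun x => fr k x ^+ 2 + fi k x ^+ 2).
  by apply: measurable_funD; exact: measurable_funX.
have mg2 k : measurable_fun L (fun x => gr k x ^+ 2 + gi k x ^+ 2).
  by apply: measurable_funD; exact: measurable_funX.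
have ms k : measurable_fun L (s k).
  apply: measurable_funM; first exact: measurable_cst.
  exact: measurable_funD.
have int_s k : (\int[lam]_(x in L) (s k x)%:E <= (2 * a k)%:E)%E.
  have [ak|ak] := ltP 0 (a k); last first.
    have -> : a k = 0 by apply/eqP; rewrite eq_le ak a0.
    rewrite mulr0 integral0_eq // => x _; rewrite /s.
    have -> : a k = 0 by apply/eqP; rewrite eq_le ak a0.
    by rewrite mul0r.
  rewrite /s; under eq_integral do rewrite EFinM EFinD.
  rewrite ge0_integralZl_EFin //; last 2 first.
  - by move=> x _; rewrite -EFinD lee_fin !addr_ge0 // sqr_ge0.
  - by apply: emeasurable_funD; exact/measurable_EFinP.
  rewrite ge0_integralD //; first last.
  - exact/measurable_EFinP.
  - by move=> x _; rewrite lee_fin addr_ge0 // sqr_ge0.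
  - exact/measurable_EFinP.
  - by move=> x _; rewrite lee_fin addr_ge0 // sqr_ge0.
  have := orthonormal_sqnorm on_phi ak; have := orthonormal_sqnorm on_psi ak.
  rewrite /sqnorm /fr /fi /gr /gi /f /g ak => -> ->.
  by rewrite -EFinD -EFinM lee_fin mulrC.
have cv_2a : cvgn (series (fun k => 2 * a k)).
  have -> : series (fun k => 2 * a k) = (fun n => 2 * series a n).
    by apply/funext => n; rewrite /series /= mulr_sumr.
  exact: is_cvgMr.
have [N1 [mN1 N1_0 s_sum]] := ae_summable mL ms s0 int_s cv_2a.
have N_null : lam.-negligible (N0 `|` N1) by apply: negligibleU => //; exists N1; split.
have s_cvg x : L x -> ~ (N0 `|` N1) x -> cvgn (series (s ^~ x)).
  move=> Lx nN; apply: contrapT => nc; apply: nN; right; apply: s_sum => /= h.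
  exact/nc/h.
have s_bound k x y (u v u' v' : R) :
    u ^+ 2 + v ^+ 2 = fr k x ^+ 2 + fi k x ^+ 2 ->
    u' ^+ 2 + v' ^+ 2 = gr k y ^+ 2 + gi k y ^+ 2 ->
    `|a k * (u * u' + v * v')| <= s k x + s k y.
  move=> uv uv'; rewrite normrM (ger0_norm (a0 k)) -mulrDr ler_wpM2l //.
  rewrite -uv -uv'.
  have := sqr_ge0 (gr k x); have := sqr_ge0 (gi k x).
  have := sqr_ge0 (fr k y); have := sqr_ge0 (fi k y).
  have := sqr_ge0 (u - u'); have := sqr_ge0 (u + u').
  have := sqr_ge0 (v - v'); have := sqr_ge0 (v + v').
  have := sqr_ge0 u; have := sqr_ge0 u'; have := sqr_ge0 v; have := sqr_ge0 v'.
  rewrite ler_norml => *; apply/andP; split; lra.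
have T_sum x y : L x -> ~ (N0 `|` N1) x -> L y -> ~ (N0 `|` N1) y ->
    series (fun k => a k * (fr k x * gr k y + fi k x * gi k y)) @ \oo
      --> complex.Re (K x y) /\
    series (fun k => a k * (fi k x * gr k y + - fr k x * gi k y)) @ \oo
      --> complex.Im (K x y).
  move=> Lx Nx Ly Ny.
  have [] := complex_cvg_Re_Im (K_sum x y (conj Lx (fun h => Nx (or_introl h)))
    (conj Ly (fun h => Ny (or_introl h)))).
  have term k : (a k)%:C%C * phi k x * (psi k y)^* =
      Complex (a k * (fr k x * gr k y + fi k x * gi k y))
        (a k * (fi k x * gr k y + - fr k x * gi k y)).
    rewrite (_ : (psi k y)^* = conjc (psi k y)) //.
    rewrite /fr /fi /gr /gi /f /g; case: ltP => ak.
      case: (phi k x) (psi k y) => [? ?] [? ?].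
      by apply/eqP; rewrite eq_complex /=; apply/andP; split; apply/eqP; ring.
    have -> : a k = 0 by apply/eqP; rewrite eq_le ak a0.
    by rewrite !mul0r.
  pose t k : R[i] := (a k)%:C%C * phi k x * (psi k y)^*.
  have ReT : (fun n => complex.Re (\sum_(k < n) t k)) =
      series (fun k => a k * (fr k x * gr k y + fi k x * gi k y)).
    by apply/funext => n; rewrite (Re_sum n t); apply: eq_bigr => k _; rewrite /t term.
  have ImT : (fun n => complex.Im (\sum_(k < n) t k)) =
      series (fun k => a k * (fi k x * gr k y + - fr k x * gi k y)).
    by apply/funext => n; rewrite (Im_sum n t); apply: eq_bigr => k _; rewrite /t term.
  by rewrite -ReT -ImT.
have nc_mul k (u v : borel E -> R) : measurable_fun L u -> measurable_fun L v ->
    nearly_constant lam L (fun x y => u x * v y).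
  move=> mu_ mv; apply: (@nearly_constantM _ _ _ _ _ (fun x _ => u x) (fun _ y => v y)).
    exact: nearly_constant_fst.
  exact: nearly_constant_snd.
split.
  apply: (nearly_constant_series mL N_null _ ms s0 _ s_cvg (K := fun x y => complex.Re (K x y))
    (k := fun k x y => a k * (fr k x * gr k y + fi k x * gi k y))).
  - move=> k; apply: nearly_constantM; first exact: nearly_constant_cst.
    by apply: nearly_constantD; apply: nc_mul.
  - by move=> k x y; apply: s_bound.
  - by move=> x y Lx Nx Ly Ny; have [] := T_sum x y Lx Nx Ly Ny.
apply: (nearly_constant_series mL N_null _ ms s0 _ s_cvg (K := fun x y => complex.Im (K x y))
  (k := fun k x y => a k * (fi k x * gr k y + - fr k x * gi k y))).
- move=> k; apply: nearly_constantM; first exact: nearly_constant_cst.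
  apply: nearly_constantD; apply: nc_mul => //.
  exact: measurableT_comp.
- by move=> k x y; apply: s_bound => //; rewrite sqrrN addrC.
- by move=> x y Lx Nx Ly Ny; have [] := T_sum x y Lx Nx Ly Ny.
Qed.

End TraceClassKernel.

(** * Alpha-determinants of order one and two *)

Section SmallAlphaDeterminants.
Variable A : comPzRingType.

Lemma card_porbits_bounds (T : finType) (s : {perm T}) :
  (#|porbits s| <= #|T|)%N /\ (forall x : T, (0 < #|porbits s|)%N).
Proof.
split; first by rewrite (leq_trans (leq_imset_card _ _)).
by move=> x; apply/card_gt0P; exists (porbit s x); apply/imsetP; exists x.
Qed.

Lemma det_alpha1 (alpha : A) (M : 'M[A]_1) : det_alpha alpha M = M ord0 ord0.
Proof.
rewrite /det_alpha (bigD1 1%g) //= [X in _ + X]big1 ?addr0; last first.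
  by move=> s /eqP s1; exfalso; apply: s1; apply/permP => i; rewrite perm1 !ord1.
have [_ /(_ ord0) c0] := card_porbits_bounds (1%g : 'S_1).
by rewrite (eqP (c0 : 1 - _ == 0)%N) expr0 mul1r big_ord1 perm1.
Qed.

(** The parity of a permutation of two points determines its number of cycles,
    which lies between one and two. *)
Lemma det_alpha2 (alpha : A) (M : 'M[A]_2) :
  det_alpha alpha M = M ord0 ord0 * M ord_max ord_max +
    alpha * (M ord0 ord_max * M ord_max ord0).
Proof.
pose tau : 'S_2 := tperm ord0 ord_max.
have ord2 (i : 'I_2) : i = ord0 \/ i = ord_max.
  by case: i => [[|[|//]] hi]; [left|right]; apply/val_inj.
have tau1 : tau != 1%g.
  by apply/eqP => /permP /(_ ord0); rewrite tpermL perm1.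
have card_even (s : 'S_2) : odd_perm s = false -> (2 - #|porbits s|)%N = 0%N.
  have [cle /(_ ord0)] := card_porbits_bounds s; move: cle.
  rewrite /odd_perm card_ord; by case: #|porbits s| => [|[|[|]]].
have card_odd (s : 'S_2) : odd_perm s = true -> (2 - #|porbits s|)%N = 1%N.
  have [cle /(_ ord0)] := card_porbits_bounds s; move: cle.
  rewrite /odd_perm card_ord; by case: #|porbits s| => [|[|[|]]].
rewrite /det_alpha (bigD1 1%g) //= (bigD1 tau) //= [X in _ + (_ + X)]big1 ?addr0; last first.
  move=> s /andP[/eqP s1 /eqP st]; case: (ord2 (s ord0)) => s0.
    case: s1; apply/permP => i; rewrite perm1; case: (ord2 i) => -> //.
    case: (ord2 (s ord_max)) => // smax.
    by have /perm_inj := etrans smax (esym s0).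
  case: st; apply/permP => i; case: (ord2 i) => ->; first by rewrite tpermL.
  rewrite tpermR; case: (ord2 (s ord_max)) => // smax.
  by have /perm_inj := etrans smax (esym s0).
rewrite card_even ?odd_perm1 // card_odd; last by rewrite odd_tperm.
rewrite expr0 expr1 mul1r !big_ord_recr !big_ord0 /= !mul1r !perm1.
have -> : widen_ord (leqnSn 1) ord_max = ord0 :> 'I_2 by exact: val_inj.
by rewrite tpermL tpermR.
Qed.

End SmallAlphaDeterminants.

(** * Repulsion against infinite divisibility *)

Lemma radon_compact_positive (R : realType) (E : ptopologicalType)
    (lam : {measure set (borel E) -> \bar R}) (B : set (borel E)) :
  radon lam -> measurable B -> (0 < lam B)%E ->
  exists C : set E, [/\ compact C, C `<=` B & (0 < lam C)%E].
Proof.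
move=> [_ lam_inner] mB B0; apply: contrapT => nC.
suff : (lam B <= 0)%E by rewrite leNgt B0.
rewrite lam_inner //; apply: ge_ereal_sup => _ [C [cC CB] <-].
by rewrite leNgt; apply/negP => C0; apply: nC; exists C.
Qed.

(** The kernel is nearly constant on a small set [C], with the positive diagonal
    value of [K] as that constant.  So [K x y * K y x] is close to a positive
    square, although nothing forces it to be real or positive for general
    [x] and [y]; [delta / 3] is small enough for this purpose. *)
Lemma kernel_positive_product (R : realType) (E : ptopologicalType)
    (lam : {measure set (borel E) -> \bar R}) (L A : set (borel E))
    (K : E -> E -> R[i]) (r : borel E -> R) (delta : R) :
  radon lam -> measurable L -> trace_class_kernel lam L K ->
  measurable A -> A `<=` L -> (0 < lam A)%E -> 0 < delta ->
  (forall x, A x -> K x x = (r x)%:C%C) -> (forall x, A x -> delta <= r x) ->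
  exists C : set E, [/\ compact C, C `<=` A, (0 < lam C)%E,
    forall x y, C x -> C y -> r y <= r x + delta / 3 &
    forall x y, C x -> C y -> delta ^+ 2 / 3 <= complex.Re (K x y * K y x)].
Proof.
move=> lam_radon mL K_tc mA AL A0 delta0 Kr r_delta.
have [K_re K_im] := trace_class_nearly_constant mL K_tc.
have e0 : 0 < delta / 3 by rewrite divr_gt0.
have [B [mB BA B0 KB]] := nearly_constant2 K_re K_im mA AL A0 e0.
have [C [C_co CB C0]] := radon_compact_positive lam_radon mB B0.
have CA x : C x -> A x by move=> /CB /BA.
exists C; split => // x y Cx Cy.
  have [] := KB y y x x (CB _ Cy) (CB _ Cy) (CB _ Cx) (CB _ Cx).
  rewrite (Kr x (CA x Cx)) (Kr y (CA y Cy)) /= ler_norml => /andP[_ ?] _; lra.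
have K_close x' y' : C x' -> C y' ->
    `|complex.Re (K x' y') - r x'| <= delta / 3 /\ `|complex.Im (K x' y')| <= delta / 3.
  move=> Cx' Cy'.
  have [] := KB x' y' x' x' (CB _ Cx') (CB _ Cy') (CB _ Cx') (CB _ Cx').
  by rewrite (Kr x' (CA x' Cx')) /= subr0.
have := K_close x y Cx Cy; have := K_close y x Cy Cx.
move: (K x y) (K y x) => [u v] [u' v'] /=.
move: (r_delta x (CA x Cx)) (r_delta y (CA y Cy)).
move: (r x) (r y) => rx ry drx dry.
rewrite !ler_norml => -[/andP[u1' _] /andP[v1' v2']] [/andP[u1 _] /andP[v1 v2]].
have uu : (2 * delta / 3) * (2 * delta / 3) <= u * u'.
  by apply: ler_pM; try lra; rewrite divr_ge0 // mulr_ge0 // ltW.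
have vv : v * v' <= (delta / 3) * (delta / 3).
  by rewrite (le_trans (ler_norm _)) // normrM ler_pM // ler_norml; apply/andP; split; lra.
have -> : delta ^+ 2 / 3 = (2 * delta / 3) * (2 * delta / 3) - (delta / 3) * (delta / 3).
  by field.
lra.
Qed.

Section CompactCovers.
Context (R : realType) (E : ptopologicalType).
Hypothesis E_polish : polish R E.
Hypothesis E_lc : locally_compact [set: E].

Lemma radon_sigma_finite (lam : {measure set (borel E) -> \bar R}) :
  radon lam -> sigma_finite setT lam.
Proof.
move=> [lam_fin _].
have [V [V_cc _ V_nbhs]] := polish_exhaustion E_polish (@E_lc).
exists V; first by rewrite exhaustion_setT.
move=> n; have [Vc Vcl] := V_cc n.
by split; [exact: closed_borel_measurable|exact: lam_fin].
Qed.

(** Countably many compact sets cover the space, so almost surely empty compact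
    sets would make the whole process almost surely empty. *)
Lemma nonempty_compact_mass d (W : measurableType d) (P : probability W R)
    (xi : {mfun W >-> config_space R E}) :
  ~ {ae P, forall w, (xi w : config R E) [set: borel E] = 0%E} ->
  exists L : set E, [/\ compact L, closed L &
    ~ {ae P, forall w, mass L (xi w) = 0}].
Proof.
move=> xi_nonempty.
have [V [V_cc _ V_nbhs]] := polish_exhaustion E_polish (@E_lc).
have mV n : measurable (V n : set (borel E)).
  by apply: closed_borel_measurable; have [] := V_cc n.
apply: contrapT => nL; apply: xi_nonempty.
have V0 n : {ae P, forall w, mass (V n) (xi w) = 0}.
  apply: contrapT => nV; apply: nL; exists (V n).
  by have [] := V_cc n; split.
apply: filterS (ae_foralln V0) => w xiV.
rewrite -(exhaustion_setT V_nbhs).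
apply: measure_negligible; first exact: bigcupT_measurable.
apply: negligible_bigcup => n; apply/negligibleP => //.
have fV := config_compact_fin_num (xi w : config R E) (V_cc n).1.
exact: (etrans (esym (fineK fV)) (congr1 EFin (xiV n))).
Qed.

End CompactCovers.

Lemma no_second_moment_gap (R : realType) (m f q : R) :
  0 < q -> (forall n : nat, n%:R / n.+1%:R * m ^+ 2 <= f) -> f + q <= m ^+ 2 -> False.
Proof.
move=> q0 fn fq.
have m2 : 0 <= m ^+ 2 := sqr_ge0 m.
pose n := Num.trunc (m ^+ 2 / q).
have := fn n; have : m ^+ 2 < n.+1%:R * q.
  by rewrite -ltr_pdivrMr // truncnS_gt.
have n0 : 0 < n.+1%:R :> R by [].
rewrite mulrAC ler_pdivrMr // => h1 h2.
have e : n.+1%:R = n%:R + 1 :> R by rewrite -natr1.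
rewrite e in h1 h2 n0.
nra.
Qed.

Theorem theorem8 (R : realType) (E : ptopologicalType)
  (E_polish : polish R E) (E_lc : locally_compact [set: E])
  (lam : {measure set (borel E) -> \bar R}) (lam_radon : radon lam)
  (alpha : R) (alpha_lt0 : alpha < 0)
  (K : E -> E -> R[i]) (K_tc : locally_trace_class lam K)
  (d : measure_display) (W : measurableType d) (P : probability W R)
  (xi : {mfun W >-> config_space R E})
  (xi_det : alpha_determinantal P lam alpha K xi)
  (xi_nonempty : ~ {ae P, forall w, (xi w : config R E) [set: borel E] = 0%E}) :
  ~ infinitely_divisible P xi.
Proof.
move: xi_det => [rho [corr rho_det]] xi_id.
have [rho_meas [rho_ge0 _]] := corr.
pose lamS : {sigma_finite_measure set (borel E) -> \bar R} :=
  sigma_finite_copy (radon_sigma_finite E_polish (@E_lc) lam_radon).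
have [L [L_co L_cl L_mass]] := nonempty_compact_mass E_polish (@E_lc) xi_nonempty.
have mL : measurable (L : set (borel E)) by exact: closed_borel_measurable.
pose r (x : borel E) := rho 1%N [tuple x].
have m_tuple1 : measurable_fun setT (fun x : borel E => [tuple x]).
  by apply/measurable_fun_tnthP => i; rewrite ord1; exact: measurable_id.
have mr : measurable_fun setT r by exact: (measurableT_comp (rho_meas 1%N) m_tuple1).
have r0 x : 0 <= r x by exact: rho_ge0.
have rho1 t : rho 1%N t = r (tnth t ord0).
  by rewrite /r; congr (rho 1%N _); apply: eq_from_tnth => i; rewrite !ord1.
have mean_mass (C : set E) : compact C -> closed C ->
    (\int[P]_w (mass C (xi w))%:E = \int[lam]_(x in C) (r x)%:E)%E.
  move=> cC clC; have mC : measurable (C : set (borel E)) by exact: closed_borel_measurable.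
  have := correlation_falling (lam := lamS) mC (n := 1) corr cC clC isT.
  under eq_integral do rewrite /falling big_ord1 subr0.
  move=> ->; rewrite -(power_measure1_cube lamS mC mr r0).
  by congr (integral _ _ _); apply/funext => t; rewrite rho1.
have L_mean : (0 < \int[lam]_(x in L) (r x)%:E)%E.
  rewrite lt0e integral_ge0 ?andbT => [|x _]; last by rewrite lee_fin.
  rewrite -mean_mass //; apply/eqP => mean0; apply: L_mass.
  have mm : measurable_fun setT (fun w => (mass L (xi w))%:E).
    apply/measurable_EFinP; apply: measurableT_comp => //.
    exact: (measurable_mass E_polish (@E_lc) L_co).
  have : (\int[P]_w `|(mass L (xi w))%:E| = 0)%E.
    by under eq_integral do rewrite gee0_abs ?lee_fin ?mass_ge0 //.
  move/(ae_eq_integral_abs P measurableT mm); apply: filterS => w /(_ I).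
  exact: EFin_inj.
have [delta delta0 Ldelta] := positive_integral_level mL mr r0 L_mean.
have mD : measurable (L `&` [set x | delta <= r x] : set (borel E)).
  by apply: measurableI => //; exact: measurable_level.
have rK : {ae lam, forall x, K x x = (r x)%:C%C}.
  apply: (@power_measure1_ae _ _ lamS (fun x => K x x = (r x)%:C%C)).
  have [m1 m1E] := power_measure_sigma_finite lamS 1.
  have := rho_det 1%N; rewrite m1E.
  by apply: filterS => t; rewrite det_alpha1 mxE => <-; rewrite rho1.
have [A [mA AD AN A0]] := positive_measure_avoid mD rK Ldelta.
have AL : A `<=` L by move=> x /AD[].
have Kr x : A x -> K x x = (r x)%:C%C.
  by move=> Ax; apply: contrapT; exact: (AN x Ax).
have [C [C_co CA C0 r_close K_prod]] := kernel_positive_product lam_radon mL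
  (K_tc L L_co) mA AL A0 delta0 Kr (fun x Ax => (AD x Ax).2).
have C_cl : closed C := compact_closed (polish_hausdorff E_polish) C_co.
have mC : measurable (C : set (borel E)) by exact: closed_borel_measurable.
(* The gap between r x * r y and rho_2 on C, written as a square so that it
   integrates over C * C to a square as well. *)
pose c := Num.sqrt (- alpha * (delta ^+ 2 / 3)).
have c2_gt0 : 0 < - alpha * (delta ^+ 2 / 3).
  by rewrite mulr_gt0 ?oppr_gt0 // divr_gt0 // exprn_gt0.
have c2 : c ^+ 2 = - alpha * (delta ^+ 2 / 3) by rewrite sqr_sqrtr // ltW.
have c_gt0 : 0 < c by rewrite sqrtr_gt0.
have rho2 : \forall t \ae power_measure lam 2, cube C (n := 2) t ->
    rho 2%N t + c ^+ 2 <= r (tnth t ord0) * r (tnth t ord_max).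
  have [m2 m2E] := power_measure_sigma_finite lamS 2.
  have m2E' : power_measure lam 2 = m2 :> (set _ -> \bar R) := m2E.
  have := rho_det 2%N; rewrite m2E'.
  apply: filterS => t rho_t tC; move: rho_t; rewrite det_alpha2 !mxE.
  set x := tnth t ord0; set y := tnth t ord_max => /(congr1 (@complex.Re R)) /=.
  have Cx : C x := tC ord0; have Cy : C y := tC ord_max.
  have := K_prod x y Cx Cy; rewrite (Kr x (CA x Cx)) (Kr y (CA y Cy)) c2.
  move: (K x y) (K y x) => [u v] [u' v'] /= uv ->.
  nra.
have lamC : (lam C < +oo)%E by have [lam_fin _] := lam_radon; exact: lam_fin.
have lamC_fin : lam C \is a fin_num by rewrite ge0_fin_numE.
pose I := (\int[lam]_(x in C) (r x)%:E)%E.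
have I_fin : I \is a fin_num.
  have [x Cx] := positive_measure_ex C0.
  rewrite ge0_fin_numE; last by apply: integral_ge0 => y _; rewrite lee_fin.
  apply: (@le_lt_trans _ _ (\int[lam]_(y in C) (cst (r x + delta / 3)%:E y))%E).
    apply: ge0_le_integral => //.
    - by move=> y _; rewrite lee_fin.
    - by apply/measurable_EFinP; exact: measurable_funTS.
    - by move=> y Cy; rewrite lee_fin r_close.
  rewrite integral_cst // lte_mul_pinfty ?lee_fin // addr_ge0 //.
  by rewrite divr_ge0 // ltW.
have second := infinitely_divisible_second_moment E_polish (@E_lc) C_co _ xi_id
  (etrans (mean_mass C C_co C_cl) (esym (fineK I_fin))).
have upper := @power_measure2_cube_le _ _ lamS C mC r (rho 2%N) c mr r0 (rho_meas 2%N)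
  (rho_ge0 2%N) (ltW c_gt0) rho2.
have fall := correlation_falling (lam := lamS) mC (n := 2) corr C_co C_cl isT.
rewrite -fall in upper.
pose F := (\int[P]_w (falling (mass C (xi w)) 2)%:E)%E.
have {}upper : (F + (c%:E * lam C) * (c%:E * lam C) <= I * I)%E by exact: upper.
have F0 : (0 <= F)%E.
  by apply: integral_ge0 => w _; rewrite lee_fin falling_mass_ge0.
have F_fin : F \is a fin_num.
  rewrite ge0_fin_numE //; apply: (@le_lt_trans _ _ (I * I)%E).
    by apply: le_trans upper; rewrite leeDl // mule_ge0 // mule_ge0 // lee_fin ltW.
  by rewrite -(fineK I_fin) -EFinM ltry.
apply: (@no_second_moment_gap _ (fine I) (fine F) ((c * fine (lam C)) ^+ 2)).
- by rewrite exprn_gt0 // mulr_gt0 // fine_gt0 // C0.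
- by move=> n; rewrite -lee_fin fineK //; exact: second.
- by rewrite -lee_fin EFinD EFinM !expr2 !EFinM !fineK.
Qed.
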